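(* Let $\kappa,m,t^*>0$. Then the following two statements are equivalent. (a) In the inertial Kuramoto system with inertia $m$ and coupling strength $\kappa$, the data $\theta_1(t^* ),\dots,\theta_N(t^* ),\dot\theta_1(0),\dots,\dot\theta_N(0)$ uniquely determine $\dot\theta_1(t^* ),\dots,\dot\theta_N(t^* )$; that is, for every integer $N\ge1$ and every $\mathcal V\in\mathbb{R}^N$, whenever $\Theta$ and $\Phi$ are two solutions of the system with $\dot\Theta(0)=\dot\Phi(0)$ and $\Theta(t^* )=\Phi(t^* )$, one has $\dot\Theta(t^* )=\dot\Phi(t^* )$. (b) Either $m\kappa\le\frac14$; or $m\kappa>\frac14$ and $$t^*\le\frac{\pi m}{\sqrt{4m\kappa-1}}+\frac{2m}{\sqrt{4m\kappa-1}}\sin^{-1}\left(\frac{1}{\sqrt{4m\kappa}}\right).$$ Furthermore, if $t^*<\max\left\{\frac1{2\kappa},\sqrt{\frac m\kappa}\right\}$, then there is a Banach contraction algorithm that determines $\dot\Theta(t^* )$ from $\Theta(t^* )$ and $\dot\Theta(0)$: for every $N\ge1$ and $\mathcal V,\Omega^0,\Theta^*\in\mathbb{R}^N$, the map $\mathcal F:(C[0,t^*])^N\to(C[0,t^*])^N$ defined in the context is a contraction for the norm $\max_i\sup_{t\in[0,t^*]}|\omega_i(t)|$, and for every solution $\Theta$ of the system with $\dot\Theta(0)=\Omega^0$ and $\Theta(t^* )=\Theta^*$, the restriction of $\dot\Theta$ to $[0,t^*]$ is the unique fixed point of $\mathcal F$ (hence the limit of the iterates $\mathcal F^n(\Omega)$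 for any starting $\Omega\in(C[0,t^*])^N$).
   Context: For $N\ge1$ and $\mathcal V=(\nu_1,\dots,\nu_N)\in\mathbb{R}^N$, the inertial Kuramoto system is $$m\ddot\theta_i+\dot\theta_i=\nu_i+\frac{\kappa}{N}\sum_{j=1}^N\sin(\theta_j-\theta_i),\qquad t\ge 0,\ i=1,\dots,N,$$ for $\Theta=(\theta_1,\dots,\theta_N):[0,\infty)\to\mathbb{R}^N$; for each initial data $(\Theta(0),\dot\Theta(0))\in\mathbb{R}^N\times\mathbb{R}^N$ it has a unique global solution. Given $\mathcal V=(\nu_i)$, $\Omega^0=(\omega_i^0)$, $\Theta^*=(\theta_i^* )\in\mathbb{R}^N$, the map $\mathcal F=(f_1,\dots,f_N)$ is defined for $\Omega=(\omega_1,\dots,\omega_N)\in(C[0,t^*])^N$ and $t\in[0,t^*]$ by $$f_i(\Omega)(t)=\omega_i^0e^{-t/m}+\nu_i(1-e^{-t/m})+\frac{\kappa}{Nm}\sum_{l=1}^N\int_0^te^{-(t-\sigma)/m}\sin\left(\theta_l^*-\theta_i^*-\int_\sigma^{t^*}(\omega_l(\tau)-\omega_i(\tau))\,d\tau\right)d\sigma.$$ *)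

(* Defs.v *)
From mathcomp Require Import all_boot.
From Stdlib Require Import Reals.
From Coquelicot Require Import Coquelicot.

Set Implicit Arguments.
Unset Strict Implicit.
Unset Printing Implicit Defensive.

Open Scope R_scope.

Definition half_line (t : R) : Prop := 0 <= t.

(* Only the values of theta and omega on [0, oo) matter. [D_in f f' half_line t]
   says that f' t is the derivative of f restricted to [0, oo): the usual
   derivative for t > 0 and the right derivative at t = 0.  Hence omega is
   determined by theta on [0, oo), and so is the acceleration alpha. *)
Definition kuramoto_solution (N : nat) (m kappa : R) (nu : 'I_N -> R)
    (theta omega : 'I_N -> R -> R) : Prop :=
  exists alpha : 'I_N -> R -> R,
    forall (i : 'I_N) (t : R), 0 <= t ->
      D_in (theta i) (omega i) half_line t /\
      D_in (omega i) (alpha i) half_line t /\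
      m * alpha i t + omega i t =
        nu i + kappa / INR N *
               \big[Rplus/0]_(j < N) sin (theta j t - theta i t).

(* An element of (C[0,T])^N is represented by total functions that are
   continuous on [0,T], two of them being identified when [eq_CN] holds. *)
Definition in_CN (N : nat) (T : R) (Omega : 'I_N -> R -> R) : Prop :=
  forall i : 'I_N, continuous_on (fun t : R => 0 <= t <= T) (Omega i).

Definition eq_CN (N : nat) (T : R) (Omega Omega' : 'I_N -> R -> R) : Prop :=
  forall (i : 'I_N) (t : R), 0 <= t <= T -> Omega i t = Omega' i t.

Definition sup_norm (T : R) (u : R -> R) : R :=
  real (Lub_Rbar (fun x : R => exists t : R, 0 <= t <= T /\ x = Rabs (u t))).

(* The suprema are nonnegative and, on continuous functions, finite; so this is
   max_i sup_[0,T] |Omega_i|. *)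
Definition norm_CN (N : nat) (T : R) (Omega : 'I_N -> R -> R) : R :=
  \big[Rmax/0]_(i < N) sup_norm T (Omega i).

Definition dist_CN (N : nat) (T : R) (Omega Omega' : 'I_N -> R -> R) : R :=
  norm_CN T (fun (i : 'I_N) (t : R) => Omega i t - Omega' i t).

Definition contraction_CN (N : nat) (T : R)
    (F : ('I_N -> R -> R) -> ('I_N -> R -> R)) : Prop :=
  (forall Omega, in_CN T Omega -> in_CN T (F Omega)) /\
  exists q : R, 0 <= q < 1 /\
    forall Omega Omega', in_CN T Omega -> in_CN T Omega' ->
      dist_CN T (F Omega) (F Omega') <= q * dist_CN T Omega Omega'.

Definition velocity_map (N : nat) (m kappa T : R)
    (nu omega0 thetaT : 'I_N -> R) (Omega : 'I_N -> R -> R)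
    : 'I_N -> R -> R :=
  fun i t =>
    omega0 i * exp (- t / m) + nu i * (1 - exp (- t / m)) +
    kappa / (INR N * m) *
    \big[Rplus/0]_(l < N)
      RInt (fun sigma : R =>
              exp (- (t - sigma) / m) *
              sin (thetaT l - thetaT i -
                   RInt (fun tau : R => Omega l tau - Omega i tau) sigma T))
           0 t.

(* Main.v *)
From HB Require Import structures.
Require Import Defs.
From mathcomp Require Import all_boot.
From Stdlib Require Import Reals Lra Classical.
From Coquelicot Require Import Coquelicot.
Set Implicit Arguments.
Unset Strict Implicit.
Unset Printing Implicit Defensive.
Open Scope R_scope.

(** Determination.  Let [d], [z] be the differences of the positions and of the
    velocities of two solutions and [F] that of the (rescaled) forces.  In the
    Euclidean norm [|F| <= |d|], strictly unless [d = 0].  If [r > 0] satisfies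
    the Riccati inequality [r' >= (kappa - r)/m + r^2], then
    [exp (t/m) (|z|^2/r - r |d|^2)] is nonincreasing.  It tends to 0 at both ends
    of [(0,T)], so it vanishes identically; this forces [|F| = |d|], hence
    [d = 0].  Such an [r] exists up to the critical time: it is the constant
    [1/(2m)] when [4 m kappa <= 1], and otherwise [- y'/y] where
    [m y'' + y' + kappa y = 0], [y'(0) = 0].

    Failure beyond the critical time.  Take two oscillators with [nu = 0], so
    that their phase difference [x] is a damped pendulum, started at rest at
    angle [a].  For [a] near [PI] it stays positive on [[0,T]]; for small [a] a
    Wronskian comparison with the linear oscillator shows that it does not.  At
    the last [a] for which it does not, [x] is nonnegative and reaches 0 at time
    [T], transversally, so it cannot be told from the rest state by its
    initial velocity and final position.

    Contraction.  A perturbation of size [e] of the velocities changes each phase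
    difference at time [s] by at most [2 (T - s) e].  Bounding either [T - s] by
    [T] or the memory kernel by 1 gives the Lipschitz constants [2 kappa T] and
    [kappa T^2 / m] for the velocity map. *)

(** * Finite sums and one-sided derivatives *)

(** These structures make the generic [\big] lemmas ([big_split], [big_distrr], [exchange_big],
    [bigD1]) available for real sums. *)
HB.instance Definition _ := Monoid.isComLaw.Build R 0 Rplus
  (fun x y z => esym (Rplus_assoc x y z)) Rplus_comm Rplus_0_l.
HB.instance Definition _ := Monoid.isMulLaw.Build R 0 Rmult Rmult_0_l Rmult_0_r.
HB.instance Definition _ := Monoid.isAddLaw.Build R Rmult Rplus
  Rmult_plus_distr_r Rmult_plus_distr_l.

Lemma rsum_le (N : nat) (f g : 'I_N -> R) : (forall i, f i <= g i) ->
  \big[Rplus/0]_(i < N) f i <= \big[Rplus/0]_(i < N) g i.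
Proof.
move=> H; elim/big_ind2: _ => [|x1 x2 y1 y2 H1 H2|i _]; [lra|lra|exact: H].
Qed.

Lemma rsum_ge0 (N : nat) (f : 'I_N -> R) : (forall i, 0 <= f i) ->
  0 <= \big[Rplus/0]_(i < N) f i.
Proof. move=> H; elim/big_ind: _ => [|x y Hx Hy|i _]; [lra|lra|exact: H]. Qed.

Lemma rsum_const (N : nat) (c : R) : \big[Rplus/0]_(i < N) c = INR N * c.
Proof.
elim: N => [|N IH]; first by rewrite big_ord0 /=; lra.
rewrite big_ord_recl IH S_INR; lra.
Qed.

Lemma term_le_rsum (N : nat) (f : 'I_N -> R) (i : 'I_N) :
  (forall j, 0 <= f j) -> f i <= \big[Rplus/0]_(j < N) f j.
Proof.
move=> H; rewrite (bigD1 i) //= -[X in X <= _]Rplus_0_r.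
apply: Rplus_le_compat_l.
by elim/big_ind: _ => [|x y Hx Hy|j _]; [lra|lra|exact: H].
Qed.

Lemma rsum_opp (N : nat) (f : 'I_N -> R) :
  \big[Rplus/0]_(i < N) - f i = - (\big[Rplus/0]_(i < N) f i).
Proof.
have -> : - (\big[Rplus/0]_(i < N) f i) = -1 * \big[Rplus/0]_(i < N) f i
  by ring.
by rewrite big_distrr /=; apply: eq_bigr => i _; ring.
Qed.

Lemma rsum_minus (N : nat) (f g : 'I_N -> R) :
  \big[Rplus/0]_(i < N) (f i - g i) =
  \big[Rplus/0]_(i < N) f i - \big[Rplus/0]_(i < N) g i.
Proof. by rewrite /Rminus big_split /= rsum_opp. Qed.

Lemma rsum_abs_le (N : nat) (f : 'I_N -> R) (B : R) :
  (forall i, Rabs (f i) <= B) ->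
  Rabs (\big[Rplus/0]_(i < N) f i) <= INR N * B.
Proof.
move=> H; rewrite -rsum_const.
elim/big_ind2: _ => [|x1 x2 y1 y2 H1 H2|i _]; last exact: H.
- rewrite Rabs_R0; lra.
- have ? := Rabs_triang x2 y2; lra.
Qed.

Lemma is_derive_rsum (N : nat) (f : 'I_N -> R -> R) (df : 'I_N -> R) (t : R) :
  (forall i, is_derive (f i) t (df i)) ->
  is_derive (fun x => \big[Rplus/0]_(i < N) f i x) t
            (\big[Rplus/0]_(i < N) df i).
Proof.
elim: N f df => [|N IH] f df H.
  rewrite big_ord0; apply: (is_derive_ext (fun _ => 0)).
    by move=> x; rewrite big_ord0.
  exact: is_derive_const.
rewrite big_ord_recl.
apply: (is_derive_ext
  (fun x => f ord0 x + \big[Rplus/0]_(i < N) f (lift ord0 i) x)).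
  by move=> x; rewrite big_ord_recl.
by apply: (is_derive_plus (V := R_NormedModule)); [exact: H | apply: IH].
Qed.

Lemma continuous_rsum (N : nat) (f : 'I_N -> R -> R) (t : R) :
  (forall i, continuous (f i) t) ->
  continuous (fun x => \big[Rplus/0]_(i < N) f i x) t.
Proof.
elim: N f => [|N IH] f H.
  apply: (continuous_ext (fun _ => 0)); last exact: continuous_const.
  by move=> x; rewrite big_ord0.
apply: (continuous_ext
  (fun x => f ord0 x + \big[Rplus/0]_(i < N) f (lift ord0 i) x)).
  by move=> x; rewrite big_ord_recl.
by apply: (continuous_plus (V := R_NormedModule)); [exact: H | apply: IH].
Qed.

Lemma is_RInt_rsum (N : nat) (f : 'I_N -> R -> R) (l : 'I_N -> R) (a b : R) :
  (forall i, is_RInt (f i) a b (l i)) ->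
  is_RInt (fun x => \big[Rplus/0]_(i < N) f i x) a b
          (\big[Rplus/0]_(i < N) l i).
Proof.
elim: N f l => [|N IH] f l H.
  rewrite big_ord0; apply: (is_RInt_ext (fun _ => 0)).
    by move=> x _; rewrite big_ord0.
  have := is_RInt_const (V := R_NormedModule) a b 0.
  by rewrite /scal /= /mult /= Rmult_0_r.
rewrite big_ord_recl.
apply: (is_RInt_ext
  (fun x => f ord0 x + \big[Rplus/0]_(i < N) f (lift ord0 i) x)).
  by move=> x _; rewrite big_ord_recl.
by apply: (is_RInt_plus (V := R_NormedModule)); [exact: H | apply: IH].
Qed.

Lemma continuous_is_derive (f : R -> R) (t l : R) :
  is_derive f t l -> continuous f t.
Proof. by move=> H; apply: ex_derive_continuous; exists l. Qed.

Lemma le_of_derive_le0 (f df : R -> R) (a b : R) : a <= b ->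
  (forall t, a <= t <= b -> is_derive f t (df t)) ->
  (forall t, a <= t <= b -> df t <= 0) -> f b <= f a.
Proof.
move=> ab Hd Hn.
have Hm : Rmin a b = a by rewrite Rmin_left.
have HM : Rmax a b = b by rewrite Rmax_right.
have [||c [Hc E]] := MVT_gen f a b df.
- rewrite Hm HM => x Hx; apply: Hd; lra.
- rewrite Hm HM => x Hx; apply/continuity_pt_filterlim.
  exact: (continuous_is_derive (Hd x Hx)).
rewrite Hm HM in Hc.
have ? := Hn c Hc; nra.
Qed.

Lemma is_derive_D_in (f f' : R -> R) (D : R -> Prop) (t : R) :
  is_derive f t (f' t) -> D_in f f' D t.
Proof.
move/is_derive_Reals => H eps Heps.
have [[d Hd] H1] := H eps Heps.
exists d; split=> // x [[_ Hx] Hdist].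
have := H1 (x - t).
have -> : t + (x - t) = x by ring.
move=> H2; apply: H2 => //; lra.
Qed.

Definition affine_extension (f : R -> R) (d t : R) : R :=
  if Rle_dec 0 t then f t else f 0 + t * d.

Lemma affine_extension_eq (f : R -> R) (d t : R) :
  0 <= t -> affine_extension f d t = f t.
Proof. by move=> Ht; rewrite /affine_extension; case: Rle_dec. Qed.

Lemma is_derive_affine_extension (f f' : R -> R) (t : R) : 0 <= t ->
  D_in f f' half_line t -> is_derive (affine_extension f (f' 0)) t (f' t).
Proof.
move=> Ht H; apply/is_derive_Reals => eps Heps.
have [d0 [Hd0 H0]] := H eps Heps.
move: d0 Hd0 H0 => /= d Hd H1.
(* For [t > 0] the radius is also at most [t], so that [t + h] stays in the half line. At [t = 0] a
   negative [h] lands on the affine piece, whose difference quotient is exactly [f' 0]. *)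
have Hd' : 0 < (if Rlt_dec 0 t then Rmin d t else d).
  by case: Rlt_dec => Ht' /=; [apply: Rmin_pos|]; lra.
exists (mkposreal _ Hd') => h Hh /=.
case: Rlt_dec => Ht' /= Habs.
  have Hm := Rmin_l d t; have Hm2 := Rmin_r d t.
  have /Rabs_def2 [Ha Hb] := Habs.
  rewrite !affine_extension_eq; [|lra|lra].
  have := H1 (t + h); rewrite /= /R_dist /Rdist.
  have -> : t + h - t = h by ring.
  move=> H2; apply: H2; split; last by lra.
  split; [rewrite /half_line; lra|lra].
have E : t = 0 by lra.
subst t; rewrite Rplus_0_l (affine_extension_eq _ _ Ht).
rewrite /affine_extension; case: Rle_dec => Hh0 /=.
  have := H1 h; rewrite /= /R_dist /Rdist.
  rewrite Rminus_0_r => H2; apply: H2; split; last by lra.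
  split; [rewrite /half_line; lra|lra].
have -> : (f 0 + h * f' 0 - f 0) / h - f' 0 = 0 by field.
rewrite Rabs_R0; lra.
Qed.

(* Extending a solution affinely to negative times turns its one-sided
   derivatives at 0 into two-sided ones. *)
Lemma kuramoto_extension (N : nat) (m kappa : R) (nu : 'I_N -> R)
    (theta omega : 'I_N -> R -> R) : 0 < m ->
  kuramoto_solution m kappa nu theta omega ->
  exists th om : 'I_N -> R -> R,
    forall (i : 'I_N) (t : R), 0 <= t ->
      [/\ th i t = theta i t, om i t = omega i t,
          is_derive (th i) t (om i t)
        & is_derive (om i) t
            ((nu i + kappa / INR N *
                \big[Rplus/0]_(j < N) sin (th j t - th i t) - om i t) / m)].
Proof.
move=> m0 [alpha H].
exists (fun i => affine_extension (theta i) (omega i 0)).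
exists (fun i => affine_extension (omega i) (alpha i 0)) => i t Ht.
have [H1 [H2 H3]] := H i t Ht.
rewrite !affine_extension_eq //; split=> //.
  exact: is_derive_affine_extension.
rewrite (eq_bigr (fun j => sin (theta j t - theta i t))); last first.
  by move=> j _; rewrite affine_extension_eq.
rewrite -H3; have -> : (m * alpha i t + omega i t - omega i t) / m = alpha i t.
  by field; lra.
exact: is_derive_affine_extension.
Qed.

Lemma exp_le (x y : R) : x <= y -> exp x <= exp y.
Proof. by case=> [H|->]; [left; exact: exp_increasing | right]. Qed.

(** * Energy estimate for the coupling force *)

(** Variance identity: it passes between pairwise differences, which the sine bound controls, and
    Euclidean norms. *)
Lemma rsum_sqr_diff (N : nat) (x : 'I_N -> R) :
  \big[Rplus/0]_(i < N) \big[Rplus/0]_(j < N) (x i - x j) ^ 2 =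
  2 * INR N * \big[Rplus/0]_(i < N) x i ^ 2 -
  2 * (\big[Rplus/0]_(i < N) x i) ^ 2.
Proof.
set A := \big[Rplus/0]_(i < N) x i ^ 2; set B := \big[Rplus/0]_(i < N) x i.
rewrite (eq_bigr (fun i => INR N * x i ^ 2 + (A + -2 * B * x i))); last first.
  move=> i _.
  rewrite (eq_bigr (fun j => x i ^ 2 + (x j ^ 2 + -2 * x i * x j)));
    last by move=> j _; ring.
  rewrite !big_split /= rsum_const -big_distrr /= -/A -/B; ring.
rewrite !big_split /= rsum_const -!big_distrr /= -/A -/B; ring.
Qed.

(* [2 N |F|^2 = sum_ij (F_i - F_j) S_ij] by antisymmetry; then AM-GM. *)
Lemma coupling_energy (N : nat) (d F : 'I_N -> R) (S : 'I_N -> 'I_N -> R) :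
  (forall i j, S j i = - S i j) ->
  (forall i, INR N * F i = \big[Rplus/0]_(j < N) S i j) ->
  INR N * \big[Rplus/0]_(i < N) F i ^ 2 + (\big[Rplus/0]_(i < N) d i) ^ 2 +
  / 2 * \big[Rplus/0]_(i < N) \big[Rplus/0]_(j < N)
          ((d i - d j) ^ 2 - S i j ^ 2)
  <= INR N * \big[Rplus/0]_(i < N) d i ^ 2.
Proof.
move=> Santi HF.
set FF := \big[Rplus/0]_(i < N) F i ^ 2.
set dd := \big[Rplus/0]_(i < N) d i ^ 2.
set SS := \big[Rplus/0]_(i < N) \big[Rplus/0]_(j < N) S i j ^ 2.
have -> : \big[Rplus/0]_(i < N) \big[Rplus/0]_(j < N)
    ((d i - d j) ^ 2 - S i j ^ 2) =
    2 * INR N * dd - 2 * (\big[Rplus/0]_(i < N) d i) ^ 2 - SS.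
  rewrite -rsum_sqr_diff -rsum_minus; apply: eq_bigr => i _.
  by rewrite rsum_minus.
have E1 : \big[Rplus/0]_(i < N) \big[Rplus/0]_(j < N) (F i * S i j) =
          INR N * FF.
  rewrite /FF big_distrr /=; apply: eq_bigr => i _.
  by rewrite -big_distrr /= -HF; ring.
have E2 : \big[Rplus/0]_(i < N) \big[Rplus/0]_(j < N) (F j * S i j) =
          - (INR N * FF).
  rewrite exchange_big /= -E1 -rsum_opp; apply: eq_bigr => i _.
  rewrite -rsum_opp; apply: eq_bigr => j _; rewrite Santi; ring.
have E3 : \big[Rplus/0]_(i < N) \big[Rplus/0]_(j < N) ((F i - F j) * S i j) =
          2 * INR N * FF.
  transitivity (INR N * FF - - (INR N * FF)); last by ring.
  rewrite -{1}E1 -E2 -rsum_minus; apply: eq_bigr => i _.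
  rewrite -rsum_minus; apply: eq_bigr => j _; ring.
have : 2 * INR N * FF <= \big[Rplus/0]_(i < N) \big[Rplus/0]_(j < N)
    (/ 2 * (F i - F j) ^ 2 + / 2 * S i j ^ 2).
  rewrite -E3; apply: rsum_le => i; apply: rsum_le => j /=.
  have ? := pow2_ge_0 (F i - F j - S i j); nra.
rewrite (eq_bigr (fun i => / 2 * \big[Rplus/0]_(j < N) (F i - F j) ^ 2 +
  / 2 * \big[Rplus/0]_(j < N) S i j ^ 2)); last first.
  by move=> i _; rewrite big_split /= -!big_distrr.
rewrite big_split /= -!big_distrr /= rsum_sqr_diff -/FF -/SS => H.
have := pow2_ge_0 (\big[Rplus/0]_(i < N) F i).
move: (\big[Rplus/0]_(i < N) F i) (\big[Rplus/0]_(i < N) d i) H => f e H H'; lra.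
Qed.

Lemma abs_sin_lt (x : R) : x <> 0 -> Rabs (sin x) < Rabs x.
Proof.
move=> Hx.
have pos y : 0 < y -> Rabs (sin y) < y.
  move=> Hy; have ? := sin_lt_x _ Hy; have ? := PI2_1.
  apply: Rabs_def1; first by [].
  have [H|H] := Rlt_le_dec 1 y; first by have ? := SIN_bound y; lra.
  have ? : 0 < sin y by apply: sin_gt_0; lra.
  lra.
have [H|[H|H]] := Rtotal_order x 0; [|by []|].
- have := pos (- x); rewrite sin_neg Rabs_Ropp (Rabs_left x) // => ?; lra.
- by rewrite (Rabs_right x); [exact: pos | lra].
Qed.

(** Sum-to-product: the difference is [2 cos ((a + b) / 2) sin ((a - b) / 2)], and the sine factor
    is strictly smaller than its argument in absolute value. *)
Lemma sin_diff_lt (a b : R) : a <> b -> Rabs (sin a - sin b) < Rabs (a - b).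
Proof.
move=> ab.
rewrite form4 !Rabs_mult (Rabs_right 2); last by lra.
have := abs_sin_lt (x := (a - b) / 2).
have : Rabs (cos ((a + b) / 2)) <= 1.
  by apply: Rabs_le; have ? := COS_bound ((a + b) / 2); lra.
rewrite Rabs_div ?(Rabs_right 2); [|lra..] => H H1.
have {}H1 := H1 ltac:(lra).
have ? := Rabs_pos (cos ((a + b) / 2)); have ? := Rabs_pos (sin ((a - b) / 2)).
nra.
Qed.

Lemma sin_diff_le (a b : R) : Rabs (sin a - sin b) <= Rabs (a - b).
Proof.
have [->|H] := Req_dec a b; last by left; exact: sin_diff_lt.
rewrite !Rminus_diag; lra.
Qed.

Lemma Rabs_le_sqr (a b : R) : Rabs a <= Rabs b -> a ^ 2 <= b ^ 2.
Proof. by move=> H; rewrite -(pow2_abs a) -(pow2_abs b); have ? := Rabs_pos a; nra. Qed.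

Section Kuramoto_difference.
Variables (N : nat) (th ph F : 'I_N -> R).
Hypothesis HF : forall i, INR N * F i =
  \big[Rplus/0]_(j < N) (sin (th j - th i) - sin (ph j - ph i)).
Hypothesis HN : 0 < INR N.

Let d i := th i - ph i.

Let S_anti i j : sin (th i - th j) - sin (ph i - ph j) =
  - (sin (th j - th i) - sin (ph j - ph i)).
Proof.
rewrite -(Ropp_minus_distr (th j)) -(Ropp_minus_distr (ph j)) !sin_neg; ring.
Qed.

Let S_le i j : (sin (th j - th i) - sin (ph j - ph i)) ^ 2 <= (d i - d j) ^ 2.
Proof.
have -> : (d i - d j) ^ 2 = ((th j - th i) - (ph j - ph i)) ^ 2.
  by rewrite /d; ring.
exact/Rabs_le_sqr/sin_diff_le.
Qed.

Let energy := coupling_energy d S_anti HF.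

(** In [energy] the squared sum of [d] and the double sum are nonnegative; dropping both leaves the
    bound. *)
Lemma kuramoto_force_le :
  \big[Rplus/0]_(i < N) F i ^ 2 <= \big[Rplus/0]_(i < N) (th i - ph i) ^ 2.
Proof.
have ? := energy.
have ? := pow2_ge_0 (\big[Rplus/0]_(i < N) d i).
have ? : 0 <= \big[Rplus/0]_(i < N) \big[Rplus/0]_(j < N)
   ((d i - d j) ^ 2 - (sin (th j - th i) - sin (ph j - ph i)) ^ 2).
  by do 2 apply: rsum_ge0 => ?; apply/Rge_le/Rge_minus/Rle_ge/S_le.
change (\big[Rplus/0]_(i < N) F i ^ 2 <= \big[Rplus/0]_(i < N) d i ^ 2).
apply: (Rmult_le_reg_l (INR N)) => //; lra.
Qed.

(** In the equality case both slack terms of [energy] vanish. No pair can then be strict in the sine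
    bound, so all [d j] coincide; as their sum is 0, each is 0. *)
Lemma kuramoto_force_eq :
  \big[Rplus/0]_(i < N) (th i - ph i) ^ 2 <= \big[Rplus/0]_(i < N) F i ^ 2 ->
  forall i, th i = ph i.
Proof.
change (\big[Rplus/0]_(i < N) d i ^ 2 <= \big[Rplus/0]_(i < N) F i ^ 2 ->
        forall i, th i = ph i).
move/(Rmult_le_compat_l _ _ _ (Rlt_le _ _ HN)) => Hle i.
have Hpos a b :
    0 <= (d a - d b) ^ 2 - (sin (th b - th a) - sin (ph b - ph a)) ^ 2.
  by have ? := S_le a b; lra.
have H2 := pow2_ge_0 (\big[Rplus/0]_(i < N) d i).
have H3 a : 0 <= \big[Rplus/0]_(j < N)
   ((d a - d j) ^ 2 - (sin (th j - th a) - sin (ph j - ph a)) ^ 2).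
  by apply: rsum_ge0.
have H4 := rsum_ge0 H3.
have H5 := energy.
have Hs : \big[Rplus/0]_(i < N) d i = 0.
  apply: Rsqr_0_uniq; rewrite /Rsqr; nra.
have Hz : \big[Rplus/0]_(a < N) \big[Rplus/0]_(j < N)
   ((d a - d j) ^ 2 - (sin (th j - th a) - sin (ph j - ph a)) ^ 2) = 0.
  nra.
have Hc j : d j = d i.
  apply: NNPP => Hne.
  have := term_le_rsum i H3; rewrite Hz.
  have := term_le_rsum j (Hpos i).
  have : Rabs (sin (th j - th i) - sin (ph j - ph i)) <
         Rabs ((th j - th i) - (ph j - ph i)).
    by apply: sin_diff_lt; move: Hne; rewrite /d => ?; lra.
  move=> H; have {H} := Rsqr_lt_abs_1 _ _ H; rewrite /Rsqr /d => *; nra.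
move: Hs; rewrite (eq_bigr (fun _ => d i)) ?rsum_const; last by [].
by rewrite /d => H; nra.
Qed.

End Kuramoto_difference.

(** * Lyapunov functional *)

Lemma is_derive_lyapunov_term (m : R) (z d r : R -> R) (dz dd dr t : R) :
  is_derive z t dz -> is_derive d t dd -> is_derive r t dr -> r t <> 0 ->
  m <> 0 ->
  is_derive (fun s => exp (s / m) * (z s ^ 2 / r s - r s * d s ^ 2)) t
    (exp (t / m) * ((z t ^ 2 / r t - r t * d t ^ 2) / m + 2 * z t * dz / r t -
       z t ^ 2 * dr / r t ^ 2 - dr * d t ^ 2 - 2 * r t * d t * dd)).
Proof.
move=> Hz Hd Hr r0 m0.
auto_derive.
  by repeat split=> //; eexists; eassumption.
have -> : Derive (fun x => z x) t = dz by exact: is_derive_unique.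
have -> : Derive (fun x => d x) t = dd by exact: is_derive_unique.
have -> : Derive (fun x => r x) t = dr by exact: is_derive_unique.
rewrite -/(Rdiv t m); field; lra.
Qed.

(* Completing squares: the left side is
   [- (z + r d)^2 - kappa/m (F - z/r)^2 - e (z^2/r^2 + d^2)] plus the right
   side, where [e >= 0] is the defect in the Riccati inequality. *)
Lemma lyapunov_term_le (m kappa z d r dr F : R) :
  0 < m -> 0 < kappa -> 0 < r -> (kappa - r) / m + r ^ 2 <= dr ->
  (z ^ 2 / r - r * d ^ 2) / m + 2 * z * ((kappa * F - z) / m) / r -
  z ^ 2 * dr / r ^ 2 - dr * d ^ 2 - 2 * r * d * z
  <= kappa / m * (F ^ 2 - d ^ 2).
Proof.
move=> m0 k0 r0 Hdr.
set e := dr - ((kappa - r) / m + r ^ 2).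
have e0 : 0 <= e by rewrite /e; lra.
apply: Rminus_le.
match goal with |- ?X <= 0 =>
  have -> : X = - ((z + r * d) ^ 2 + kappa / m * (F - z / r) ^ 2 +
                   e * ((z / r) ^ 2 + d ^ 2)) end.
  rewrite /e; field; lra.
have ? := pow2_ge_0 (z + r * d).
have ? := pow2_ge_0 d; have ? := pow2_ge_0 (z / r).
have ? : 0 <= kappa / m * (F - z / r) ^ 2.
  by apply: Rmult_le_pos; [left; exact: Rdiv_lt_0_compat | exact: pow2_ge_0].
nra.
Qed.

(** The form [f (a + h) = o(h)] in which the endpoint data enter: squared velocity differences at
    time 0, squared position differences at time [T]. *)
Lemma is_derive_eq0_small (f : R -> R) (a eps : R) : f a = 0 ->
  is_derive f a 0 -> 0 < eps ->
  exists d, 0 < d /\ forall h, Rabs h < d -> Rabs (f (a + h)) <= eps * Rabs h.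
Proof.
move=> f0 /is_derive_Reals H Heps.
have [[d Hd] H1] := H eps Heps.
exists d; split=> // h Hh.
have [->|h0] := Req_dec h 0; first by rewrite Rplus_0_r f0 Rabs_R0; lra.
have := H1 h h0 Hh; rewrite f0 !Rminus_0_r Rabs_div // => H2.
have Hp := Rabs_pos_lt _ h0.
left; apply: (Rmult_lt_reg_r (/ Rabs h)); first exact: Rinv_0_lt_compat.
rewrite Rmult_assoc Rinv_r; lra.
Qed.

Lemma is_derive_eq_open (f g : R -> R) (a b t l l' : R) : a < t < b ->
  (forall s, a < s < b -> f s = g s) ->
  is_derive f t l -> is_derive g t l' -> l = l'.
Proof.
move=> Ht Heq Hf Hg.
rewrite -(is_derive_unique _ _ _ Hf) -(is_derive_unique _ _ _ Hg).
apply: Derive_ext_loc.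
have Hd : 0 < Rmin (t - a) (b - t) by apply: Rmin_pos; lra.
exists (mkposreal _ Hd) => y /= /Rabs_def2; rewrite /minus /plus /opp /= => Hy.
apply: Heq.
have ? := Rmin_l (t - a) (b - t); have ? := Rmin_r (t - a) (b - t); lra.
Qed.

Lemma eq_right_end (f g : R -> R) (a b : R) : a < b ->
  (forall s, a < s < b -> f s = g s) ->
  continuous f b -> continuous g b -> f b = g b.
Proof.
move=> ab Heq Hf Hg.
have Hc : continuous (fun s => f s - g s) b.
  exact: (continuous_minus (V := R_NormedModule)).
apply: Rminus_diag_uniq; apply: NNPP => Hne.
have [d Hd] := Hc _ (locally_ball (f b - g b) (mkposreal _ (Rabs_pos_lt _ Hne))).
have ? := cond_pos d.
set s := b - Rmin (d / 2) ((b - a) / 2).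
have Hm : 0 < Rmin (d / 2) ((b - a) / 2) by apply: Rmin_pos; lra.
have ? := Rmin_l (d / 2) ((b - a) / 2); have ? := Rmin_r (d / 2) ((b - a) / 2).
have Hs : a < s < b by rewrite /s; lra.
have := Hd s; rewrite /ball /= /AbsRing_ball /abs /minus /plus /opp /= => H.
have {H} := H ltac:(by apply: Rabs_def1; rewrite /s; lra).
have -> : f s + - g s + - (f b - g b) = - (f b - g b) by rewrite Heq //; ring.
rewrite Rabs_Ropp; lra.
Qed.

(** * Determination from a Riccati supersolution *)

Section Determination.
Variables (m kappa T c C : R) (r r' : R -> R).
Hypotheses (m_gt0 : 0 < m) (kappa_gt0 : 0 < kappa) (T_gt0 : 0 < T).
Hypotheses (c_gt0 : 0 < c) (C_gt0 : 0 < C).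
Hypothesis r_derive : forall t, 0 < t < T -> is_derive r t (r' t).
Hypothesis r_riccati :
  forall t, 0 < t < T -> (kappa - r t) / m + r t ^ 2 <= r' t.
(** The two growth bounds let [r] vanish linearly at 0 and have a simple pole at [T], which is
    exactly its behavior at the critical time. They still suffice for the limits of the functional
    at both ends. *)
Hypothesis r_lower : forall t, 0 < t < T -> c * t <= r t.
Hypothesis r_upper : forall t, 0 < t < T -> r t * (T - t) <= C.

Variables (N : nat) (nu : 'I_N -> R) (th om ph ch : 'I_N -> R -> R).
Hypothesis N_gt0 : 0 < INR N.
Hypothesis th_derive : forall i t, 0 <= t -> is_derive (th i) t (om i t).
Hypothesis ph_derive : forall i t, 0 <= t -> is_derive (ph i) t (ch i t).
Hypothesis om_derive : forall i t, 0 <= t -> is_derive (om i) t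
  ((nu i + kappa / INR N * \big[Rplus/0]_(j < N) sin (th j t - th i t)
    - om i t) / m).
Hypothesis ch_derive : forall i t, 0 <= t -> is_derive (ch i) t
  ((nu i + kappa / INR N * \big[Rplus/0]_(j < N) sin (ph j t - ph i t)
    - ch i t) / m).
Hypothesis velocity_start : forall i, om i 0 = ch i 0.
Hypothesis position_end : forall i, th i T = ph i T.

Let d i t := th i t - ph i t.
Let z i t := om i t - ch i t.
Let F i t := / INR N *
  \big[Rplus/0]_(j < N) (sin (th j t - th i t) - sin (ph j t - ph i t)).

Let d_derive i t : 0 <= t -> is_derive (d i) t (z i t).
Proof.
move=> Ht; apply: (is_derive_minus (V := R_NormedModule)).
- exact: th_derive.
- exact: ph_derive.
Qed.

Let z_derive i t : 0 <= t -> is_derive (z i) t ((kappa * F i t - z i t) / m).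
Proof.
move=> Ht.
have -> : (kappa * F i t - z i t) / m =
  minus ((nu i + kappa / INR N * \big[Rplus/0]_(j < N) sin (th j t - th i t)
    - om i t) / m)
  ((nu i + kappa / INR N * \big[Rplus/0]_(j < N) sin (ph j t - ph i t)
    - ch i t) / m).
  rewrite /F rsum_minus /minus /plus /opp /= /z; field; lra.
apply: (is_derive_minus (V := R_NormedModule)).
- exact: om_derive.
- exact: ch_derive.
Qed.

Let F_def i t : INR N * F i t =
  \big[Rplus/0]_(j < N) (sin (th j t - th i t) - sin (ph j t - ph i t)).
Proof. by rewrite /F -Rmult_assoc Rinv_r ?Rmult_1_l; lra. Qed.

Let r_gt0 t : 0 < t < T -> 0 < r t.
Proof. by move=> Ht; have ? := r_lower Ht; nra. Qed.

Let Q t := \big[Rplus/0]_(i < N)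
  (exp (t / m) * (z i t ^ 2 / r t - r t * d i t ^ 2)).

Let dQ t := \big[Rplus/0]_(i < N)
  (exp (t / m) * ((z i t ^ 2 / r t - r t * d i t ^ 2) / m +
     2 * z i t * ((kappa * F i t - z i t) / m) / r t -
     z i t ^ 2 * r' t / r t ^ 2 - r' t * d i t ^ 2 - 2 * r t * d i t * z i t)).

Let Q_derive t : 0 < t < T -> is_derive Q t (dQ t).
Proof.
move=> Ht; apply: is_derive_rsum => i; apply: is_derive_lyapunov_term.
- apply: z_derive; lra.
- apply: d_derive; lra.
- exact: r_derive.
- by have ? := r_gt0 Ht; lra.
- lra.
Qed.

Let dQ_le t : 0 < t < T -> dQ t <= exp (t / m) * (kappa / m) *
  (\big[Rplus/0]_(i < N) F i t ^ 2 - \big[Rplus/0]_(i < N) d i t ^ 2).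
Proof.
move=> Ht; rewrite -rsum_minus big_distrr /=; apply: rsum_le => i /=.
rewrite [X in _ <= X]Rmult_assoc; apply: Rmult_le_compat_l; first by left; exact: exp_pos.
by apply: lyapunov_term_le => //; [exact: r_gt0 | exact: r_riccati].
Qed.

Let exp_km t : 0 < exp (t / m) * (kappa / m).
Proof.
by apply: Rmult_lt_0_compat; [exact: exp_pos | exact: Rdiv_lt_0_compat].
Qed.

Let Q_decr s t : 0 < s -> s <= t -> t < T -> Q t <= Q s.
Proof.
move=> Hs Hst Ht; apply: (@le_of_derive_le0 Q dQ) => // u Hu.
  by apply: Q_derive; lra.
have Hu' : 0 < u < T by lra.
apply: (Rle_trans _ _ _ (dQ_le Hu')).
have ? := kuramoto_force_le (F_def ^~ u) N_gt0.
have ? := exp_km u.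
rewrite /d; nra.
Qed.

Let ZZ t := \big[Rplus/0]_(i < N) z i t ^ 2.
Let DD t := \big[Rplus/0]_(i < N) d i t ^ 2.

Let QE t : 0 < t < T -> Q t = exp (t / m) * (ZZ t / r t - r t * DD t).
Proof.
move=> Ht; have ? := r_gt0 Ht.
rewrite /Q -big_distrr /= rsum_minus -big_distrr /=.
by congr (_ * (_ - _)); rewrite /ZZ /Rdiv -big_distrl.
Qed.

Let sqr_sum_derive (f : 'I_N -> R -> R) (df : 'I_N -> R) t :
  (forall i, is_derive (f i) t (df i)) -> (forall i, f i t = 0) ->
  is_derive (fun s => \big[Rplus/0]_(i < N) f i s ^ 2) t 0.
Proof.
move=> H f0.
have E : \big[Rplus/0]_(i < N) (2 * f i t * df i) = 0.
  by rewrite big1 // => i _; rewrite f0; ring.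
rewrite -[X in is_derive _ _ X]E.
apply: is_derive_rsum => i.
have := is_derive_pow (f i) 2 t _ (H i).
by congr is_derive; rewrite /=; ring.
Qed.

Let sqr_sum_eq0 (f : 'I_N -> R -> R) t : (forall i, f i t = 0) ->
  \big[Rplus/0]_(i < N) f i t ^ 2 = 0.
Proof. by move=> H; rewrite big1 // => i _; rewrite H; ring. Qed.

Let exp_bounds t : 0 < t < T -> 0 < exp (t / m) <= exp (T / m).
Proof.
move=> Ht; split; first exact: exp_pos.
left; apply: exp_increasing; apply: Rmult_lt_compat_r; last by lra.
exact: Rinv_0_lt_compat.
Qed.

(** Since [z] vanishes at 0, [ZZ s] is [o(s)] while [r s >= c * s]. Hence [ZZ s / r s] tends to 0,
    so a positive value of [Q] could not persist backwards to 0 as monotonicity demands. *)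
Let Q_le0 t : 0 < t < T -> Q t <= 0.
Proof.
move=> Ht; apply: Rnot_lt_le => Qpos.
have z0 i : z i 0 = 0 by rewrite /z velocity_start; ring.
have Hz := sqr_sum_derive (fun i => z_derive i (Rle_refl 0)) z0.
(* With this [eps] the estimate near 0 reads [Q s <= Q t / 2], against [Q t <= Q s]. *)
set eps := Q t * c / (2 * exp (T / m)).
have HT := exp_pos (T / m).
have Heps : 0 < eps by apply: Rdiv_lt_0_compat; nra.
have [h [h0 Hh]] := is_derive_eq0_small (sqr_sum_eq0 z0) Hz Heps.
set s := Rmin t (h / 2).
have s0 : 0 < s by apply: Rmin_pos; lra.
have st : s <= t by exact: Rmin_l.
have sh : s <= h / 2 by exact: Rmin_r.
have Hs : 0 < s < T by lra.
have := Hh s; rewrite Rplus_0_l (Rabs_right s); last by lra.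
rewrite -/(ZZ s) => H1; have {}H1 := H1 ltac:(lra).
have {}H1 : ZZ s <= eps * s by apply: Rle_trans H1; exact: Rle_abs.
have HQ := Q_decr s0 st (proj2 Ht).
have ? := r_lower Hs; have ? := r_gt0 Hs.
have HD : 0 <= DD s by apply: rsum_ge0 => i; exact: pow2_ge_0.
have HZ : 0 <= ZZ s by apply: rsum_ge0 => i; exact: pow2_ge_0.
have [E1 E2] := exp_bounds Hs.
have H2 : ZZ s / r s <= eps / c.
  apply: (Rmult_le_reg_r (r s)) => //.
  have -> : ZZ s / r s * r s = ZZ s by field; lra.
  apply: (Rle_trans _ _ _ H1).
  have -> : eps * s = eps / c * (c * s) by field; lra.
  by apply: Rmult_le_compat_l => //; left; exact: Rdiv_lt_0_compat.
have H3 : Q s <= exp (T / m) * (eps / c).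
  rewrite QE //; apply: (Rle_trans _ (exp (s / m) * (eps / c))).
    apply: Rmult_le_compat_l; nra.
  by apply: Rmult_le_compat_r => //; left; exact: Rdiv_lt_0_compat.
have H4 : exp (T / m) * (eps / c) = Q t / 2 by rewrite /eps; field; lra.
lra.
Qed.

(** Mirror argument at [T]: there [d] vanishes, so [DD] is [o(T - t)], while [r] is at most
    [C / (T - t)]; thus [r * DD] tends to 0. *)
Let Q_ge0 t : 0 < t < T -> 0 <= Q t.
Proof.
move=> Ht; apply: Rnot_lt_le => Qneg.
have d0 i : d i T = 0 by rewrite /d position_end; ring.
have Hd := sqr_sum_derive (fun i => d_derive i (Rlt_le _ _ T_gt0)) d0.
(* Chosen to give [Q (T - u) >= Q t / 2 > Q t], against monotonicity. *)
set eps := - Q t / (2 * C * exp (T / m)).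
have HT := exp_pos (T / m).
have Heps : 0 < eps by apply: Rdiv_lt_0_compat; nra.
have [h [h0 Hh]] := is_derive_eq0_small (sqr_sum_eq0 d0) Hd Heps.
set u := Rmin (T - t) (h / 2).
have u0 : 0 < u by apply: Rmin_pos; lra.
have ut : u <= T - t by exact: Rmin_l.
have uh : u <= h / 2 by exact: Rmin_r.
have Hs : 0 < T - u < T by lra.
have := Hh (- u); rewrite Rabs_Ropp (Rabs_right u); last by lra.
rewrite -/(Rminus T u) -/(DD (T - u)) => H1; have {}H1 := H1 ltac:(lra).
have {}H1 : DD (T - u) <= eps * u by apply: Rle_trans H1; exact: Rle_abs.
have HQ : Q (T - u) <= Q t by apply: Q_decr; lra.
have := r_upper Hs; have -> : T - (T - u) = u by ring.
move=> Hr.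
have ? := r_gt0 Hs.
have HZ : 0 <= ZZ (T - u) / r (T - u).
  apply: Rmult_le_pos; last by left; exact: Rinv_0_lt_compat.
  by apply: rsum_ge0 => i; exact: pow2_ge_0.
have [E1 E2] := exp_bounds Hs.
have H2 : r (T - u) * DD (T - u) <= C * eps by nra.
have H3 : - (exp (T / m) * (C * eps)) <= Q (T - u).
  rewrite QE //; have ? : 0 < C * eps by nra.
  nra.
have H4 : exp (T / m) * (C * eps) = - Q t / 2 by rewrite /eps; field; lra.
lra.
Qed.

(** As [Q] is identically 0, so is [dQ]; its upper bound then forces the force norm to be at least
    the position norm, which is the equality case. *)
Let positions_agree t : 0 < t < T -> forall i, th i t = ph i t.
Proof.
move=> Ht; apply: (kuramoto_force_eq (F_def ^~ t) N_gt0).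
have E : dQ t = 0.
  apply: (is_derive_eq_open (g := fun _ => 0) Ht _ (Q_derive Ht)).
    by move=> s Hs; apply: Rle_antisym; [exact: Q_le0 | exact: Q_ge0].
  exact: (is_derive_const (V := R_NormedModule)).
have := dQ_le Ht; rewrite E.
have := exp_km t.
rewrite /d; nra.
Qed.

Lemma velocities_agree i : om i T = ch i T.
Proof.
apply: (eq_right_end T_gt0).
- move=> t Ht; apply: (is_derive_eq_open Ht (fun s Hs => positions_agree Hs i)).
  + by apply: th_derive; lra.
  + by apply: ph_derive; lra.
- exact: (continuous_is_derive (om_derive i (Rlt_le _ _ T_gt0))).
- exact: (continuous_is_derive (ch_derive i (Rlt_le _ _ T_gt0))).
Qed.

End Determination.

(** * The critical time *)

(** By the mean value theorem [sin x = x cos c] with [c] in [[0, x]], and cosine decreases on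
    [[0, PI / 2]]. *)
Lemma sin_ge_cos_mul (x b : R) : 0 <= x <= b -> b <= PI / 2 ->
  x * cos b <= sin x.
Proof.
move=> Hx Hb.
have [||c [Hc E]] := MVT_gen sin 0 x cos.
- by move=> y _; apply/is_derive_Reals/derivable_pt_lim_sin.
- by move=> y _; exact: continuity_sin.
rewrite Rmin_left ?Rmax_right in Hc; [|lra..].
rewrite sin_0 !Rminus_0_r in E.
rewrite E Rmult_comm; apply: Rmult_le_compat_r; first by lra.
have ? := PI_RGT_0.
apply: cos_decr_1; lra.
Qed.

(** Halving the angle brings [[0, b]] into [[0, PI / 2)], where the previous bound controls the sine
    and the cosine stays above [cos (b / 2)]. *)
Lemma sin_ge_linear (b : R) : 0 <= b < PI ->
  exists c, 0 < c /\ forall x, 0 <= x <= b -> c * x <= sin x.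
Proof.
move=> Hb; have Hc : 0 < cos (b / 2) by apply: cos_gt_0; lra.
exists (cos (b / 2) * cos (b / 2)); split; first by nra.
move=> x Hx; have -> : x = 2 * (x / 2) by field.
rewrite sin_2a.
have H1 : x / 2 * cos (b / 2) <= sin (x / 2) by apply: sin_ge_cos_mul; lra.
have H2 : cos (b / 2) <= cos (x / 2) by apply: cos_decr_1; lra.
have H3 : x / 2 * cos (b / 2) * cos (b / 2) <= sin (x / 2) * cos (x / 2).
  by apply: Rmult_le_compat; nra.
lra.
Qed.

(* The first positive zero of [cos x + sin x / w].  With
   [w = sqrt (4 m kappa - 1)] and [x = w t / (2m)] this is, up to the factor
   [exp (- t / (2m))], the linearized equation started at rest. *)
Definition phase_root (w : R) : R := PI - atan w.

Lemma phase_root_bounds (w : R) : 0 < w -> PI / 2 < phase_root w < PI.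
Proof.
move=> Hw; have := atan_bound w; have := atan_increasing 0 w Hw.
rewrite atan_0 /phase_root => *; lra.
Qed.

Lemma sin_phase_root (w : R) : sin (phase_root w) = w / sqrt (1 + w²).
Proof. by rewrite /phase_root sin_PI_x sin_atan. Qed.

Lemma cos_phase_root (w : R) : cos (phase_root w) = - (1 / sqrt (1 + w²)).
Proof. by rewrite /phase_root Rtrigo_facts.cos_pi_minus cos_atan. Qed.

(** Identifies the stated threshold with the first zero of the linear oscillator started at rest,
    through [asin (1 / sqrt q) = PI / 2 - atan (sqrt (q - 1))]. *)
Lemma threshold_phase_root (m kappa : R) : 0 < m -> 1 < 4 * m * kappa ->
  PI * m / sqrt (4 * m * kappa - 1) +
  2 * m / sqrt (4 * m * kappa - 1) * asin (1 / sqrt (4 * m * kappa)) =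
  phase_root (sqrt (4 * m * kappa - 1)) / (sqrt (4 * m * kappa - 1) / (2 * m)).
Proof.
move=> m0 Hk; set q := 4 * m * kappa in Hk *.
have s0 : 0 < sqrt (q - 1) by apply: sqrt_lt_R0; lra.
have q0 : 0 < sqrt q by apply: sqrt_lt_R0; lra.
have q1 : 1 < sqrt q by rewrite -sqrt_1; apply: sqrt_lt_1_alt; lra.
have Hi : 0 < 1 / sqrt q < 1.
  split; first by apply: Rdiv_lt_0_compat; lra.
  apply: (Rmult_lt_reg_r (sqrt q)) => //.
  have -> : 1 / sqrt q * sqrt q = 1 by field; lra.
  lra.
have -> : asin (1 / sqrt q) = PI / 2 - atan (sqrt (q - 1)).
  rewrite asin_atan; last by lra.
  have -> : 1 - (1 / sqrt q)² = (q - 1) / q.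
    transitivity (1 - 1 / (sqrt q * sqrt q)); first by rewrite /Rsqr; field; lra.
    by rewrite sqrt_sqrt; [field|]; lra.
  rewrite sqrt_div_alt; last by lra.
  have -> : 1 / sqrt q / (sqrt (q - 1) / sqrt q) = / sqrt (q - 1).
    by field; lra.
  exact: atan_inv.
rewrite /phase_root; field; lra.
Qed.

Lemma kuramoto_determination (m kappa T : R) : 0 < kappa -> 0 < m -> 0 < T ->
  m * kappa <= 1 / 4 \/
  (m * kappa > 1 / 4 /\
     T <= PI * m / sqrt (4 * m * kappa - 1) +
          2 * m / sqrt (4 * m * kappa - 1) * asin (1 / sqrt (4 * m * kappa))) ->
  forall (N : nat) (nu : 'I_N -> R) (theta theta' phi phi' : 'I_N -> R -> R),
    (1 <= N)%nat ->
    kuramoto_solution m kappa nu theta theta' ->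
    kuramoto_solution m kappa nu phi phi' ->
    (forall i : 'I_N, theta' i 0 = phi' i 0) ->
    (forall i : 'I_N, theta i T = phi i T) ->
    forall i : 'I_N, theta' i T = phi' i T.
Proof.
move=> k0 m0 T0 Hb N nu theta theta' phi phi' N1 Hth Hph Hstart Hend i.
have [th [om H1]] := kuramoto_extension m0 Hth.
have [ph [ch H2]] := kuramoto_extension m0 Hph.
have HN : 0 < INR N by apply/lt_0_INR/leP.
have Hstart' j : om j 0 = ch j 0.
  have [_ -> _ _] := H1 j 0 (Rle_refl 0).
  by have [_ -> _ _] := H2 j 0 (Rle_refl 0).
have Hend' j : th j T = ph j T.
  have [-> _ _ _] := H1 j T (Rlt_le _ _ T0).
  by have [-> _ _ _] := H2 j T (Rlt_le _ _ T0).
have [_ <- _ _] := H1 i T (Rlt_le _ _ T0).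
have [_ <- _ _] := H2 i T (Rlt_le _ _ T0).
have Hd1 j t : 0 <= t -> is_derive (th j) t (om j t) by case/(H1 j t).
have Hd2 j t : 0 <= t -> is_derive (ph j) t (ch j t) by case/(H2 j t).
have Hd3 j t (Ht : 0 <= t) := let: And4 _ _ _ h := H1 j t Ht in h.
have Hd4 j t (Ht : 0 <= t) := let: And4 _ _ _ h := H2 j t Ht in h.
have [Hsmall|[Hk HT]] := Hb.
(* The constant [1 / (2 * m)] minimizes [(kappa - r) / m + r ^ 2]; the minimum
   [(m * kappa - 1 / 4) / m ^ 2] is at most 0. *)
- apply: (velocities_agree (c := 1 / (2 * m) / T) (C := 1 / (2 * m) * T)
    (r := fun _ => 1 / (2 * m)) (r' := fun _ => 0) (nu := nu)
    m0 k0 T0 _ _ _ _ _ _ HN Hd1 Hd2 Hd3 Hd4 Hstart' Hend').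
  + by apply: Rdiv_lt_0_compat => //; apply: Rdiv_lt_0_compat; lra.
  + by apply: Rmult_lt_0_compat => //; apply: Rdiv_lt_0_compat; lra.
  + by move=> t _; exact: (is_derive_const (V := R_NormedModule)).
  + move=> t _.
    have -> : (kappa - 1 / (2 * m)) / m + (1 / (2 * m)) ^ 2 =
              (m * kappa - 1 / 4) * / m ^ 2 by field; lra.
    have ? : 0 < / m ^ 2 by apply: Rinv_0_lt_compat; nra.
    nra.
  + move=> t Ht; have H : 0 < 1 / (2 * m) by apply: Rdiv_lt_0_compat; lra.
    have -> : 1 / (2 * m) / T * t = 1 / (2 * m) * (t / T) by field; lra.
    rewrite -[X in _ <= X]Rmult_1_r; apply: Rmult_le_compat_l; first by lra.
    by apply/Rle_div_l; lra.
  + move=> t Ht; apply: Rmult_le_compat_l; last by lra.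
    by left; apply: Rdiv_lt_0_compat; lra.
rewrite threshold_phase_root in HT; [|lra..].
set s := sqrt (4 * m * kappa - 1) in HT.
set w := s / (2 * m) in HT.
set q := sqrt (4 * m * kappa).
have s0 : 0 < s by apply: sqrt_lt_R0; lra.
have q0 : 0 < q by apply: sqrt_lt_R0; lra.
have Hs : s * s = 4 * m * kappa - 1 by apply: sqrt_sqrt; lra.
have Hq : sqrt (1 + s²) = q by rewrite /Rsqr Hs /q; congr sqrt; ring.
have Hqq : q * q = 4 * m * kappa by apply: sqrt_sqrt; lra.
have w0 : 0 < w by apply: Rdiv_lt_0_compat; lra.
have [Hp1 Hp2] := phase_root_bounds s0; set p := phase_root s in HT Hp1 Hp2.
have HwT : w * T <= p.
  have {}HT := Rmult_le_compat_l w _ _ (Rlt_le _ _ w0) HT.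
  have E : w * (p / w) = p by field; lra.
  lra.
have Hpi := PI_RGT_0.
have [c [c0 Hc]] : exists c, 0 < c /\ forall x, 0 <= x <= p -> c * x <= sin x.
  by apply: sin_ge_linear; lra.
have Hphase t : 0 < t < T -> 0 < w * t /\ w * (T - t) <= p - w * t <= p.
  by move=> Ht; nra.
have Hsin t : 0 < t < T -> 0 < sin (p - w * t).
  by move=> Ht; have ? := Hphase t Ht; apply: sin_gt_0; nra.
(* This is [- y' / y] for [y t = exp (- t / (2 * m)) * sin (p - w * t)], so the Riccati relation
   holds with equality. *)
set r := fun t => 1 / (2 * m) + w * cos (p - w * t) / sin (p - w * t).
(* The choice of [p] gives [y' 0 = 0], so the numerator collapses to a multiple of [sin (w * t)].
   This form displays the zero of [r] at 0 and its pole at [p / w], which is not before [T]. *)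
have rE t : 0 < t < T ->
    r t = q / (2 * m) * (sin (w * t) / sin (p - w * t)).
  move=> Ht; have ? := Hsin t Ht.
  have E : sin (p - w * t) + s * cos (p - w * t) = q * sin (w * t).
    rewrite sin_minus cos_minus /p sin_phase_root cos_phase_root Hq.
    have -> : s / q * cos (w * t) - - (1 / q) * sin (w * t) +
      s * (- (1 / q) * cos (w * t) + s / q * sin (w * t)) =
      (1 + s * s) / q * sin (w * t) by field; lra.
    rewrite Hs (_ : 1 + (4 * m * kappa - 1) = q * q); [field|]; lra.
  rewrite /r -[q / _ * _]/(q / (2 * m) * (sin (w * t) * / sin (p - w * t))).
  have -> : q / (2 * m) * (sin (w * t) * / sin (p - w * t)) =
    q * sin (w * t) / (2 * m) * / sin (p - w * t) by field; lra.
  rewrite -E; have -> : s = 2 * m * w by rewrite /w; field; lra.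
  by field; lra.
have wm : w * w = kappa / m - 1 / (4 * m * m).
  have -> : w * w = s * s / (4 * m * m) by rewrite /w; field; lra.
  by rewrite Hs; field; lra.
have qm : 0 < q / (2 * m) by apply: Rdiv_lt_0_compat; lra.
(* Both constants come from [c * x <= sin x] on [[0, p]]: applied to the numerator it bounds [r]
   from below, applied to the denominator, with [p - w * t >= w * (T - t)], it bounds [r] from
   above. The other sine is at most 1. *)
apply: (velocities_agree (c := q / (2 * m) * (c * w)) (C := q / (2 * m) / (c * w))
    (r := r) (r' := fun t => w * w * (1 + (cos (p - w * t) / sin (p - w * t)) ^ 2))
    (nu := nu)
    m0 k0 T0 _ _ _ _ _ _ HN Hd1 Hd2 Hd3 Hd4 Hstart' Hend').
- by apply: Rmult_lt_0_compat => //; nra.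
- by apply: Rdiv_lt_0_compat => //; nra.
- move=> t Ht; have ? := Hsin t Ht; rewrite /r.
  have Hne : sin (p + - (w * t)) <> 0 by rewrite -/(Rminus p (w * t)); lra.
  by auto_derive => //; rewrite -/(Rminus p (w * t)) in Hne *; field.
- move=> t Ht; have ? := Hsin t Ht; rewrite /r.
  apply: Req_le; set x := cos (p - w * t) / sin (p - w * t).
  have -> : w * cos (p - w * t) / sin (p - w * t) = w * x.
    by rewrite /x; field; lra.
  have -> : (kappa - (1 / (2 * m) + w * x)) / m + (1 / (2 * m) + w * x) ^ 2 =
    kappa / m - 1 / (4 * m * m) + w * w * x ^ 2 by field; lra.
  by rewrite -wm; ring.
- move=> t Ht; have ? := Hsin t Ht; rewrite rE // Rmult_assoc.
  apply: Rmult_le_compat_l; first by lra.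
  have [H3 [H4 H5]] := Hphase t Ht.
  have ? : 0 < w * (T - t) by apply: Rmult_lt_0_compat; lra.
  have ? := Hc (w * t) ltac:(lra).
  have ? := SIN_bound (p - w * t).
  have ? : 0 < c * (w * t) by apply: Rmult_lt_0_compat; lra.
  by apply/(Rle_div_r _ _ (sin (p - w * t))) => //; nra.
- move=> t Ht; have ? := Hsin t Ht; rewrite rE //.
  have [H3 [H4 H5]] := Hphase t Ht.
  have ? : 0 < w * (T - t) by apply: Rmult_lt_0_compat; lra.
  have H6 := Hc (p - w * t) ltac:(lra).
  have ? := SIN_bound (w * t).
  rewrite Rmult_assoc; apply: Rmult_le_compat_l; first by lra.
  have Hcw : 0 < c * w by nra.
  have -> : sin (w * t) / sin (p - w * t) * (T - t) =
    sin (w * t) * (T - t) / sin (p - w * t) by field; lra.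
  apply/(Rle_div_l _ _ (sin (p - w * t))) => //.
  apply: (Rmult_le_reg_l (c * w)) => //.
  have -> : c * w * (/ (c * w) * sin (p - w * t)) = sin (p - w * t).
    by field; lra.
  have ? : c * w * (T - t) <= sin (p - w * t) by nra.
  have ? : 0 <= c * w * (T - t) by nra.
  nra.
Qed.

(** * Existence for the damped pendulum *)

Lemma is_derive_RInt_continuous (f : R -> R) (a t : R) :
  (forall s, continuous f s) -> is_derive (fun u => RInt f a u) t (f t).
Proof.
move=> Hf; apply: is_derive_RInt => //.
apply: filter_forall => u; apply: RInt_correct.
by apply: ex_RInt_continuous => ? _.
Qed.

(** Geometric increments make the sequence Cauchy, and the series tail gives the rate. It provides
    the limit of the Picard iterates together with an explicit error. *)
Lemma geometric_lim_seq (u : nat -> R) (B : R) : 0 <= B ->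
  (forall n, Rabs (u n.+1 - u n) <= B * (/ 2) ^ n) ->
  forall n, Rabs (real (Lim_seq u) - u n) <= 2 * B * (/ 2) ^ n.
Proof.
move=> B0 H.
have pow_half n : 0 < (/ 2) ^ n by apply: pow_lt; lra.
(* The factor [1 - (/ 2) ^ p], the exact partial geometric sum, is what makes the induction on [p]
   close. *)
have Hp n p : Rabs (u (n + p)%nat - u n) <= 2 * B * (/ 2) ^ n * (1 - (/ 2) ^ p).
  elim: p => [|p IH].
    by rewrite addn0 Rminus_diag Rabs_R0 /=; lra.
  have -> : u (n + p.+1)%nat - u n =
    (u (n + p).+1 - u (n + p)%nat) + (u (n + p)%nat - u n).
    by rewrite addnS; ring.
  apply: (Rle_trans _ _ _ (Rabs_triang _ _)).
  have := H (n + p)%nat.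
  have -> : (/ 2) ^ (n + p) = (/ 2) ^ n * (/ 2) ^ p by rewrite -plusE pow_add.
  rewrite /= => ?; lra.
have Hp' n p : Rabs (u (n + p)%nat - u n) <= 2 * B * (/ 2) ^ n.
  have ? := Hp n p; have ? := pow_half p; have ? := pow_half n.
  have ? : 0 <= B * (/ 2) ^ n by nra.
  nra.
have Hlim : is_lim_seq u (real (Lim_seq u)).
  apply: Lim_seq_correct'; apply/ex_lim_seq_cauchy_corr => eps.
  have Hc : 0 < eps / (4 * B + 1).
    by apply: Rdiv_lt_0_compat; [exact: cond_pos | lra].
  have [K HK] := pow_lt_1_zero (/ 2)
    ltac:(rewrite Rabs_right; lra) _ Hc.
  exists K => n p Hn Hp2.
  have H1 := Hp' K (n - K)%nat; have H2 := Hp' K (p - K)%nat.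
  rewrite !subnKC in H1 H2; [|by apply/leP..].
  have -> : u n - u p = (u n - u K) + - (u p - u K) by ring.
  apply: (Rle_lt_trans _ _ _ (Rabs_triang _ _)); rewrite Rabs_Ropp.
  have H3 := HK K (le_n K); rewrite Rabs_right in H3; last first.
    by have ? := pow_half K; lra.
  have {}H3 : (/ 2) ^ K * (4 * B + 1) < eps by apply/Rlt_div_r => //; lra.
  have ? := pow_half K.
  lra.
move=> n; apply: (is_lim_seq_le (fun p => Rabs (u (p + n)%nat - u n))
  (fun _ => 2 * B * (/ 2) ^ n) (Rabs (real (Lim_seq u) - u n))
  (2 * B * (/ 2) ^ n)).
- by move=> p; rewrite addnC.
- apply: (is_lim_seq_abs _ (real (Lim_seq u) - u n)).
  apply: (is_lim_seq_minus' _ (fun _ => u n)).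
    by apply/(is_lim_seq_incr_n u n).
  exact: is_lim_seq_const.
- exact: is_lim_seq_const.
Qed.

Lemma geometric_small (B eps : R) : 0 < eps ->
  exists n, B * (/ 2) ^ n < eps.
Proof.
move=> Heps; have Hc : 0 < eps / (Rabs B + 1).
  by apply: Rdiv_lt_0_compat => //; have ? := Rabs_pos B; lra.
have [n Hn] := pow_lt_1_zero (/ 2) ltac:(rewrite Rabs_right; lra) _ Hc.
exists n; have := Hn n (le_n n).
have Hp : 0 < (/ 2) ^ n by apply: pow_lt; lra.
rewrite Rabs_right => [H|]; last by lra.
have ? := Rabs_pos B; have ? := Rle_abs B.
have : (/ 2) ^ n * (Rabs B + 1) < eps by apply/Rlt_div_r => //; lra.
nra.
Qed.

Section Pendulum.
Variables (m k : R).
Hypotheses (m_gt0 : 0 < m) (k_gt0 : 0 < k).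

(** Integrated variation of constants for [m x'' + x' + k sin x = 0], [x 0 = a], [x' 0 = 0]. The
    exponential of [(s - t) / m] is written as a product so that the factor in [t] can leave the
    integral. *)
Definition pendulum_op (a : R) (u : R -> R) (t : R) : R :=
  a + RInt (fun s => k * (exp (- t / m) * exp (s / m) - 1) * sin (u s)) 0 t.

(* Composing with [Rabs] keeps the estimates on [0, oo) while all iterates stay
   continuous on the whole line. *)
Fixpoint pendulum_iter (a : R) (n : nat) (t : R) : R :=
  match n with
  | O => 0
  | S n' => pendulum_op a (pendulum_iter a n') (Rabs t)
  end.

Definition pendulum_limit (a t : R) : R :=
  real (Lim_seq (fun n => pendulum_iter a n t)).

(** One further application of the operator makes the solution differentiable on the whole line by
    construction; [pendulum_limit_eq] identifies it with the limit on [[0, oo)]. *)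
Definition pendulum (a t : R) : R := pendulum_op a (pendulum_limit a) t.

Definition pendulum_velocity (a t : R) : R :=
  - (k / m) * exp (- t / m) *
  RInt (fun s => exp (s / m) * sin (pendulum_limit a s)) 0 t.

Lemma continuous_exp_div (t : R) : continuous (fun s => exp (s / m)) t.
Proof.
apply: ex_derive_continuous; auto_derive => //.
Qed.

Lemma continuous_sin_comp (u : R -> R) (t : R) : continuous u t ->
  continuous (fun s => sin (u s)) t.
Proof.
by move=> H; apply: (continuous_comp u sin) => //; exact: continuous_sin.
Qed.

Lemma pendulum_opE (a : R) (u : R -> R) (t : R) :
  (forall s, continuous u s) ->
  pendulum_op a u t = a - k * RInt (fun s => sin (u s)) 0 t +
    k * exp (- t / m) * RInt (fun s => exp (s / m) * sin (u s)) 0 t.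
Proof.
move=> Hu; rewrite /pendulum_op.
rewrite (RInt_ext _ (fun s =>
  minus (scal (k * exp (- t / m)) (exp (s / m) * sin (u s)))
        (scal k (sin (u s))))); last first.
  by move=> s _; rewrite /minus /plus /opp /scal /= /mult /=; ring.
have H1 : ex_RInt (fun s => sin (u s)) 0 t.
  by apply: ex_RInt_continuous => s _; exact: continuous_sin_comp.
have H2 : ex_RInt (fun s => exp (s / m) * sin (u s)) 0 t.
  apply: ex_RInt_continuous => s _.
  apply: (continuous_mult (K := R_AbsRing)); first exact: continuous_exp_div.
  exact: continuous_sin_comp.
rewrite RInt_minus; [|by apply: ex_RInt_scal..].
rewrite !RInt_scal // /minus /plus /opp /scal /= /mult /=; ring.
Qed.

(** The kernel vanishes at [s = t], so the two endpoint terms [k * sin (u t)] cancel and only the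
    derivative of the exponential factor survives. *)
Lemma is_derive_pendulum_op (a : R) (u : R -> R) (t : R) :
  (forall s, continuous u s) ->
  is_derive (pendulum_op a u) t
    (- (k / m) * exp (- t / m) * RInt (fun s => exp (s / m) * sin (u s)) 0 t).
Proof.
move=> Hu.
apply: (is_derive_ext (fun t => a - k * RInt (fun s => sin (u s)) 0 t +
    k * exp (- t / m) * RInt (fun s => exp (s / m) * sin (u s)) 0 t)).
  by move=> s; rewrite pendulum_opE.
have H1 : is_derive (fun t => RInt (fun s => sin (u s)) 0 t) t (sin (u t)).
  apply: (is_derive_RInt_continuous (f := fun s => sin (u s))) => s.
  exact: continuous_sin_comp.
have H2 : is_derive (fun t => RInt (fun s => exp (s / m) * sin (u s)) 0 t) t
    (exp (t / m) * sin (u t)).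
  apply: (is_derive_RInt_continuous (f := fun s => exp (s / m) * sin (u s))) => s.
  apply: (continuous_mult (K := R_AbsRing)); first exact: continuous_exp_div.
  exact: continuous_sin_comp.
move: H1 H2.
set I := (fun t => RInt (fun s => sin (u s)) 0 t).
set J := (fun t => RInt (fun s => exp (s / m) * sin (u s)) 0 t).
move=> H1 H2.
apply: (is_derive_ext (fun t => a - k * I t + k * exp (- t / m) * J t)) => //.
have E1 : Derive (fun x => I x) t = sin (u t) by exact: is_derive_unique.
have E2 : Derive (fun x => J x) t = exp (t / m) * sin (u t).
  exact: is_derive_unique.
auto_derive; first by repeat split=> //; eexists; eassumption.
rewrite E1 E2 -/(J t) -/(Rdiv (- t) m).
have E : exp (- t / m) * exp (t / m) = 1.
  by rewrite -exp_plus -exp_0; congr exp; field; lra.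
have -> : forall X Y, X + k * exp (- t / m) * (1 * (exp (t / m) * Y)) =
   X + k * (exp (- t / m) * exp (t / m)) * Y by move=> X Y; ring.
rewrite E; field; lra.
Qed.

Lemma continuous_pendulum_op (a : R) (u : R -> R) :
  (forall s, continuous u s) -> forall t, continuous (pendulum_op a u) t.
Proof.
by move=> Hu t; exact: (continuous_is_derive (is_derive_pendulum_op a t Hu)).
Qed.

(** The weight [exp (2 * k * s)] gives contraction factor [1 / 2] on intervals of any length: the
    kernel is at most [k] in absolute value, and [k * D * exp (2 * k * s)] has antiderivative
    [D / 2 * exp (2 * k * s)]. *)
Lemma pendulum_op_contract (a D t : R) (u w : R -> R) : 0 <= t ->
  (forall s, continuous u s) -> (forall s, continuous w s) ->
  (forall s, 0 <= s <= t -> Rabs (u s - w s) <= D * exp (2 * k * s)) ->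
  Rabs (pendulum_op a u t - pendulum_op a w t) <= D / 2 * exp (2 * k * t).
Proof.
move=> t0 Hu Hw HD.
have Hcont v : (forall s, continuous v s) -> ex_RInt
    (fun s => k * (exp (- t / m) * exp (s / m) - 1) * sin (v s)) 0 t.
  move=> Hv; apply: ex_RInt_continuous => s _.
  apply: (continuous_mult (K := R_AbsRing)); last exact: continuous_sin_comp.
  by apply: ex_derive_continuous; auto_derive.
have -> : pendulum_op a u t - pendulum_op a w t =
    RInt (fun s => minus (k * (exp (- t / m) * exp (s / m) - 1) * sin (u s))
                 (k * (exp (- t / m) * exp (s / m) - 1) * sin (w s))) 0 t.
  rewrite RInt_minus; [|exact: Hcont..].
  rewrite /pendulum_op /minus /plus /opp /=; ring.
have D0 : 0 <= D.
  have := HD 0 ltac:(lra); rewrite Rmult_0_r exp_0 Rmult_1_r.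
  by have ? := Rabs_pos (u 0 - w 0) => ?; lra.
apply: (Rle_trans _ (D / 2 * exp (2 * k * t) - D / 2 * exp (2 * k * 0)));
  last by have ? := exp_pos (2 * k * 0); nra.
match goal with |- Rabs ?I <= _ => change (norm (V := R_NormedModule) I <=
  minus (D / 2 * exp (2 * k * t)) (D / 2 * exp (2 * k * 0))) end.
apply: norm_RInt_le t0 _ _ _; first last.
- apply: (is_RInt_derive (fun s => D / 2 * exp (2 * k * s))
    (fun s => k * (D * exp (2 * k * s)))).
    by move=> s _; auto_derive => //; field.
  by move=> s _; apply: ex_derive_continuous; auto_derive.
- apply: RInt_correct.
  by apply: ex_RInt_continuous => s _;
    apply: (continuous_minus (V := R_NormedModule));
    (apply: (continuous_mult (K := R_AbsRing)); last exact: continuous_sin_comp);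
    apply: ex_derive_continuous; auto_derive.
- move=> s Hs.
  have -> : minus (k * (exp (- t / m) * exp (s / m) - 1) * sin (u s))
                 (k * (exp (- t / m) * exp (s / m) - 1) * sin (w s)) =
    k * ((exp (- t / m) * exp (s / m) - 1) * (sin (u s) - sin (w s))).
    rewrite /minus /plus /opp /=; ring.
  rewrite /norm /= /abs /= !Rabs_mult (Rabs_right k); last by lra.
  apply: Rmult_le_compat_l; first by lra.
  have He : Rabs (exp (- t / m) * exp (s / m) - 1) <= 1.
    have -> : exp (- t / m) * exp (s / m) = exp (- ((t - s) / m)).
      by rewrite -exp_plus; congr exp; field; lra.
    have ? := exp_pos (- ((t - s) / m)).
    have ? : exp (- ((t - s) / m)) <= 1.
      rewrite -exp_0; apply: exp_le.
      have ? : 0 <= (t - s) / m by apply: Rdiv_le_0_compat; lra.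
      lra.
    apply: Rabs_le; lra.
  apply: (Rle_trans _ (1 * (D * exp (2 * k * s)))); last by lra.
  apply: Rmult_le_compat => //; try exact: Rabs_pos.
  by apply: (Rle_trans _ _ _ (sin_diff_le _ _)); exact: HD.
Qed.

Lemma pendulum_op_zero (a t : R) : pendulum_op a (fun _ => 0) t = a.
Proof.
rewrite /pendulum_op (RInt_ext _ (fun _ => 0)).
  by rewrite RInt_const /scal /= /mult /=; ring.
by move=> s _; rewrite sin_0 Rmult_0_r.
Qed.

Lemma continuous_pendulum_iter (a : R) (n : nat) (t : R) :
  continuous (pendulum_iter a n) t.
Proof.
elim: n t => [|n IH] t /=; first exact: continuous_const.
apply: (continuous_comp Rabs (pendulum_op a (pendulum_iter a n))).
  exact: continuous_Rabs.
exact: continuous_pendulum_op.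
Qed.

Lemma pendulum_iter_step (a : R) (n : nat) (t : R) :
  Rabs (pendulum_iter a n.+1 t - pendulum_iter a n t) <=
  Rabs a * exp (2 * k * Rabs t) * (/ 2) ^ n.
Proof.
elim: n t => [|n IH] t.
  rewrite /= pendulum_op_zero Rminus_0_r Rmult_1_r.
  have ? := Rabs_pos a; have ? := Rabs_pos t.
  have ? : 1 <= exp (2 * k * Rabs t) by rewrite -exp_0; apply: exp_le; nra.
  nra.
have -> : Rabs a * exp (2 * k * Rabs t) * (/ 2) ^ n.+1 =
    (Rabs a * (/ 2) ^ n) / 2 * exp (2 * k * Rabs t) by rewrite /=; field.
apply: (@pendulum_op_contract a _ (Rabs t) (pendulum_iter a n.+1) (pendulum_iter a n)).
- exact: Rabs_pos.
- by move=> s; exact: (@continuous_pendulum_iter a n.+1 s).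
- exact: continuous_pendulum_iter.
- move=> s Hs; apply: (Rle_trans _ _ _ (IH s)).
  rewrite (Rabs_right s); lra.
Qed.

Lemma pendulum_limit_dist (a : R) (n : nat) (t : R) :
  Rabs (pendulum_limit a t - pendulum_iter a n t) <=
  2 * Rabs a * (/ 2) ^ n * exp (2 * k * Rabs t).
Proof.
have -> : 2 * Rabs a * (/ 2) ^ n * exp (2 * k * Rabs t) =
   2 * (Rabs a * exp (2 * k * Rabs t)) * (/ 2) ^ n by ring.
apply: (geometric_lim_seq (u := fun n => pendulum_iter a n t)).
  by apply: Rmult_le_pos; [exact: Rabs_pos | left; exact: exp_pos].
by move=> p; exact: pendulum_iter_step.
Qed.

(** Locally uniform limit of continuous functions: [n] is chosen for the weight at [Rabs t + 1], so
    it serves every [s] within distance 1 of [t]. *)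
Lemma continuous_pendulum_limit (a t : R) : continuous (pendulum_limit a) t.
Proof.
apply/filterlim_locally => eps.
have Heps : 0 < eps / 3 by have ? := cond_pos eps; lra.
have [n Hn] := geometric_small
  (2 * Rabs a * exp (2 * k * (Rabs t + 1))) Heps.
have near s : Rabs (s - t) < 1 ->
    Rabs (pendulum_limit a s - pendulum_iter a n s) < eps / 3.
  move=> Hs; apply: (Rle_lt_trans _ _ _ (pendulum_limit_dist a n s)).
  apply: Rle_lt_trans Hn.
  have ? : exp (2 * k * Rabs s) <= exp (2 * k * (Rabs t + 1)).
    apply: exp_le; apply: Rmult_le_compat_l; first by lra.
    have ? := Rabs_triang_inv s t; lra.
  have ? := Rabs_pos a.
  have ? : 0 < (/ 2) ^ n by apply: pow_lt; lra.
  have ? : 0 <= 2 * Rabs a * (/ 2) ^ n by nra.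
  nra.
have Hc := @continuous_pendulum_iter a n t.
move/filterlim_locally: Hc => /(_ (mkposreal _ Heps)) Hc.
have H1 : locally t (fun s => Rabs (s - t) < 1).
  by exists (mkposreal 1 Rlt_0_1) => s; rewrite /ball /= /AbsRing_ball /abs /minus.
apply: filter_imp (filter_and _ _ Hc H1) => s [].
rewrite /ball /= /AbsRing_ball /abs /minus /plus /opp /= => H2 H3.
have H4 := near s H3.
have H5 := near t ltac:(rewrite Rminus_diag Rabs_R0; lra).
have -> : pendulum_limit a s + - pendulum_limit a t =
  (pendulum_limit a s - pendulum_iter a n s) +
  ((pendulum_iter a n s + - pendulum_iter a n t) +
   - (pendulum_limit a t - pendulum_iter a n t)) by ring.
apply: (Rle_lt_trans _ _ _ (Rabs_triang _ _)).
have := Rabs_triang (pendulum_iter a n s + - pendulum_iter a n t)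
   (- (pendulum_limit a t - pendulum_iter a n t)).
rewrite Rabs_Ropp => ?; lra.
Qed.

(** Both sides are within [Rabs a * (/ 2) ^ n * exp (2 * k * t)] of iterate [n.+1], one by the
    convergence rate, the other by contraction. *)
Lemma pendulum_limit_eq (a t : R) : 0 <= t -> pendulum_limit a t = pendulum a t.
Proof.
move=> t0; apply: NNPP => Hne.
have Hpos : 0 < Rabs (pendulum_limit a t - pendulum a t).
  by apply: Rabs_pos_lt; lra.
have [n Hn] := geometric_small (2 * Rabs a * exp (2 * k * Rabs t)) Hpos.
have H1 := pendulum_limit_dist a n.+1 t.
have H2 : Rabs (pendulum_op a (pendulum_iter a n) t - pendulum a t) <=
    2 * Rabs a * (/ 2) ^ n / 2 * exp (2 * k * t).
  apply: pendulum_op_contract => //.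
  - exact: continuous_pendulum_iter.
  - exact: continuous_pendulum_limit.
  - move=> s Hs; rewrite Rabs_minus_sym.
    by have := pendulum_limit_dist a n s; rewrite (Rabs_right s) //; lra.
rewrite /= (Rabs_right t) in H1 Hn; try lra.
have := Rabs_triang (pendulum_limit a t - pendulum_op a (pendulum_iter a n) t)
  (pendulum_op a (pendulum_iter a n) t - pendulum a t).
have -> : pendulum_limit a t - pendulum_op a (pendulum_iter a n) t +
  (pendulum_op a (pendulum_iter a n) t - pendulum a t) =
  pendulum_limit a t - pendulum a t by ring.
move=> ?; lra.
Qed.

Lemma is_derive_pendulum (a t : R) :
  is_derive (pendulum a) t (pendulum_velocity a t).
Proof. exact/is_derive_pendulum_op/continuous_pendulum_limit. Qed.

Lemma is_derive_pendulum_velocity (a t : R) : 0 <= t ->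
  is_derive (pendulum_velocity a) t
    ((- k * sin (pendulum a t) - pendulum_velocity a t) / m).
Proof.
move=> t0; rewrite -pendulum_limit_eq //.
have H2 : is_derive
    (fun t => RInt (fun s => exp (s / m) * sin (pendulum_limit a s)) 0 t) t
    (exp (t / m) * sin (pendulum_limit a t)).
  apply: (is_derive_RInt_continuous
    (f := fun s => exp (s / m) * sin (pendulum_limit a s))) => s.
  apply: (continuous_mult (K := R_AbsRing)); first exact: continuous_exp_div.
  exact/continuous_sin_comp/continuous_pendulum_limit.
rewrite /pendulum_velocity; move: H2.
set J := (fun t => RInt (fun s => exp (s / m) * sin (pendulum_limit a s)) 0 t).
move=> H2.
apply: (is_derive_ext (fun t => - (k / m) * exp (- t / m) * J t)) => //.
have E2 : Derive (fun x => J x) t = exp (t / m) * sin (pendulum_limit a t).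
  exact: is_derive_unique.
auto_derive; first by repeat split=> //; eexists; eassumption.
rewrite E2 -/(J t) -/(Rdiv (- t) m).
have E : exp (- t / m) * exp (t / m) = 1.
  by rewrite -exp_plus -exp_0; congr exp; field; lra.
have -> : forall X Y c, X + c * exp (- t / m) * (1 * (exp (t / m) * Y)) =
   X + c * (exp (- t / m) * exp (t / m)) * Y by move=> X Y c; ring.
rewrite E; field; lra.
Qed.

Lemma pendulum_at0 (a : R) : pendulum a 0 = a.
Proof. by rewrite /pendulum /pendulum_op RInt_point /zero /=; ring. Qed.

Lemma pendulum_velocity_at0 (a : R) : pendulum_velocity a 0 = 0.
Proof. by rewrite /pendulum_velocity RInt_point /zero /=; ring. Qed.

End Pendulum.

(** * Shooting *)

Definition pendulum_ode (m k : R) (x v : R -> R) : Prop :=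
  forall t, 0 <= t -> is_derive x t (v t) /\
    is_derive v t ((- k * sin (x t) - v t) / m).

(** AM-GM and the Lipschitz bound for sine give [Rabs (dE t) <= L * E t], so [exp (- L * t) * E t]
    is nonincreasing and [exp (L * t) * E t] nondecreasing. The forward bound yields Lipschitz
    dependence on the amplitude, the backward one uniqueness from final data. *)
Lemma pendulum_gronwall (m k : R) (x v y u : R -> R) (T : R) :
  0 < m -> 0 < k -> 0 <= T -> pendulum_ode m k x v -> pendulum_ode m k y u ->
  let L := 1 + (k + 2) / m in
  let E t := (x t - y t) ^ 2 + (v t - u t) ^ 2 in
  E T <= exp (L * T) * E 0 /\ E 0 <= exp (L * T) * E T.
Proof.
move=> m0 k0 T0 Hx Hy L E.
set dE := fun t => 2 * (x t - y t) * (v t - u t) +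
  2 * (v t - u t) * ((- k * (sin (x t) - sin (y t)) - (v t - u t)) / m).
have HE t : 0 <= t -> is_derive E t (dE t).
  move=> Ht; have [Hx1 Hx2] := Hx t Ht; have [Hy1 Hy2] := Hy t Ht.
  rewrite /E; auto_derive; first by repeat split=> //; eexists; eassumption.
  have -> : Derive (fun s => x s) t = v t by exact: is_derive_unique.
  have -> : Derive (fun s => y s) t = u t by exact: is_derive_unique.
  have -> := is_derive_unique (fun s => v s) _ _ Hx2.
  have -> := is_derive_unique (fun s => u s) _ _ Hy2.
  rewrite /dE; field; lra.
have HdE t : Rabs (dE t) <= L * E t.
  have H1 : Rabs (sin (x t) - sin (y t)) <= Rabs (x t - y t).
    exact: sin_diff_le.
  rewrite /dE /L /E; move: (x t - y t) (v t - u t) (sin (x t) - sin (y t)) H1.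
  move=> a b s /Rabs_le_sqr Hs.
  have -> : 2 * b * ((- k * s - b) / m) =
    - (k / m * (2 * s * b)) - 2 * / m * b ^ 2 by field; lra.
  have -> : (1 + (k + 2) / m) * (a ^ 2 + b ^ 2) = (a ^ 2 + b ^ 2) +
    k / m * (a ^ 2 + b ^ 2) + 2 * / m * (a ^ 2 + b ^ 2) by field; lra.
  have km : 0 < k / m by apply: Rdiv_lt_0_compat.
  have im : 0 < / m by apply: Rinv_0_lt_compat.
  have ? := pow2_ge_0 a; have ? := pow2_ge_0 b.
  have ? := pow2_ge_0 (a - b); have ? := pow2_ge_0 (a + b).
  have ? : k / m * (2 * s * b) <= k / m * (a ^ 2 + b ^ 2).
    by apply: Rmult_le_compat_l; [lra | have ? := pow2_ge_0 (s - b); lra].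
  have ? : - (k / m * (a ^ 2 + b ^ 2)) <= k / m * (2 * s * b).
    rewrite Ropp_mult_distr_r; apply: Rmult_le_compat_l; first by lra.
    by have ? := pow2_ge_0 (s + b); lra.
  have ? : 0 <= / m * b ^ 2 by apply: Rmult_le_pos; lra.
  have ? : 0 <= / m * a ^ 2 by apply: Rmult_le_pos; lra.
  apply: Rabs_le; lra.
have HL (c t : R) : is_derive (fun s => exp (c * s)) t (c * exp (c * t)).
  by auto_derive => //; ring.
have HG c t : 0 <= t -> is_derive (fun s => exp (c * s) * E s) t
    (exp (c * t) * (c * E t + dE t)).
  move=> Ht; have := is_derive_mult _ _ _ _ _ (HL c t) (HE t Ht)
    (fun _ _ => Rmult_comm _ _).
  by congr is_derive; rewrite /plus /mult /=; ring.
have e0 c t := exp_pos (c * t).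
split.
- have := le_of_derive_le0 (f := fun s => exp (- L * s) * E s) T0
    (fun t Ht => HG (- L) t (proj1 Ht)).
  rewrite Rmult_0_r exp_0 Rmult_1_l => H.
  have {}H : exp (- L * T) * E T <= E 0.
    apply: H => t Ht; have := HdE t => /Rabs_le_between ?.
    have ? := e0 (- L) t; nra.
  have -> : E T = exp (L * T) * (exp (- L * T) * E T).
    by rewrite -Rmult_assoc -exp_plus -[LHS]Rmult_1_l -exp_0;
      congr (exp _ * _); ring.
  by apply: Rmult_le_compat_l => //; left; exact: exp_pos.
- have := le_of_derive_le0 (f := fun s => - (exp (L * s) * E s)) T0
    (fun t Ht => is_derive_opp _ _ _ (HG L t (proj1 Ht))).
  rewrite Rmult_0_r exp_0 Rmult_1_l => H.
  suff : - (exp (L * T) * E T) <= - E 0 by move=> ?; lra.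
  apply: H => t Ht; have := HdE t => /Rabs_le_between ?.
  have ? := e0 L t; rewrite /opp /=; nra.
Qed.

(** Used for the rest positions 0 and [PI], to which small and large amplitudes are compared. *)
Lemma pendulum_ode_const (m k p : R) : sin p = 0 ->
  pendulum_ode m k (fun _ => p) (fun _ => 0).
Proof.
move=> Hp t _; split; first exact: (is_derive_const (V := R_NormedModule)).
have -> : (- k * sin p - 0) / m = 0 by rewrite Hp /Rdiv; ring.
exact: (is_derive_const (V := R_NormedModule)).
Qed.

(* Wronskian comparison with the linear oscillator [y] of smaller stiffness [k']
   started at rest, which vanishes at time [phase_root s / w <= T]. *)
Lemma pendulum_not_positive (m k s T b : R) (x v : R -> R) :
  0 < m -> 0 < s -> phase_root s / (s / (2 * m)) <= T ->
  pendulum_ode m k x v -> v 0 = 0 ->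
  (forall y, 0 <= y <= b -> (1 + s * s) / (4 * m) * y <= k * sin y) ->
  ~ (forall t, 0 <= t <= T -> 0 < x t <= b).
Proof.
move=> m0 s0 HT Hx v0 Hb Hpos.
set k' := (1 + s * s) / (4 * m) in Hb.
set p := phase_root s in HT; set w := s / (2 * m) in HT.
have w0 : 0 < w by apply: Rdiv_lt_0_compat; lra.
have [Hp1 Hp2] := phase_root_bounds s0; rewrite -/p in Hp1 Hp2.
have Hpi := PI_RGT_0.
set y := fun t => exp (- t / (2 * m)) * sin (p - w * t).
set y' := fun t => exp (- t / (2 * m)) *
  (- sin (p - w * t) / (2 * m) - w * cos (p - w * t)).
have Hy t : is_derive y t (y' t).
  by rewrite /y /y'; auto_derive => //; rewrite /Rdiv /Rminus; field; lra.
have Hy' t : is_derive y' t ((- k' * y t - y' t) / m).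
  have -> : k' = m * (w * w) + 1 / (4 * m) by rewrite /k' /w; field; lra.
  by rewrite /y /y'; auto_derive => //; rewrite /Rdiv /Rminus; field; lra.
set T1 := p / w in HT.
have T1pos : 0 < T1 by apply: Rdiv_lt_0_compat; lra.
have wT1 : w * T1 = p by rewrite /T1; field; lra.
(* The factor [exp (t / m)] cancels the friction terms, so the weighted Wronskian is nondecreasing
   wherever [k sin x >= k' x]. It starts at 0 since both motions start at rest, yet at [T1], where
   [y] vanishes decreasingly, it would be negative. *)
have HW t : 0 <= t -> is_derive (fun t => exp (t / m) * (x t * y' t - v t * y t)) t
    (exp (t / m) * y t * (k * sin (x t) - k' * x t) / m).
  move=> Ht; have [Hx1 Hx2] := Hx t Ht.
  auto_derive.
    by repeat split=> //; eexists; (eassumption || exact: Hy || exact: Hy').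
  have -> : Derive (fun s => x s) t = v t by exact: is_derive_unique.
  have -> := is_derive_unique (fun s => v s) _ _ Hx2.
  have -> : Derive (fun s => y s) t = y' t by exact/is_derive_unique/Hy.
  have -> := is_derive_unique (fun s => y' s) _ _ (Hy' t).
  rewrite -/(Rdiv t m); field; lra.
have y'0 : y' 0 = 0.
  rewrite /y' Rmult_0_r Rminus_0_r /p sin_phase_root cos_phase_root.
  have Hq : 0 < sqrt (1 + s²) by apply: sqrt_lt_R0; have ? := Rle_0_sqr s; lra.
  by rewrite /w; field; lra.
have H := @le_of_derive_le0 (fun t => - (exp (t / m) * (x t * y' t - v t * y t)))
  _ 0 T1 (Rlt_le _ _ T1pos) (fun t Ht => is_derive_opp _ _ _ (HW t (proj1 Ht))).
rewrite y'0 v0 in H.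
have {}H : - (exp (T1 / m) * (x T1 * y' T1 - v T1 * y T1)) <= 0.
  apply: (Rle_trans _ (- (exp (0 / m) * (x 0 * 0 - 0 * y 0)))); last by lra.
  apply: H => t Ht; rewrite /opp /=.
  have [x1 x2] := Hpos t ltac:(lra).
  have ? := Hb (x t) ltac:(lra).
  have y0 : 0 <= y t.
    apply: Rmult_le_pos; first by left; exact: exp_pos.
    by apply: sin_ge_0; nra.
  have ? : 0 <= exp (t / m) * y t * (k * sin (x t) - k' * x t) / m.
    apply: Rmult_le_pos; last by left; exact: Rinv_0_lt_compat.
    apply: Rmult_le_pos; last by lra.
    by apply: Rmult_le_pos => //; left; exact: exp_pos.
  lra.
have yT1 : y T1 = 0 by rewrite /y wT1 Rminus_diag sin_0; ring.
have y'T1 : y' T1 < 0.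
  rewrite /y' wT1 Rminus_diag sin_0 cos_0.
  have ? := exp_pos (- T1 / (2 * m)).
  have -> : - 0 / (2 * m) - w * 1 = - w by field; lra.
  nra.
rewrite yT1 in H.
have [x1 _] := Hpos T1 ltac:(lra).
have ? := exp_pos (T1 / m).
have ? : 0 < x T1 * - y' T1 by apply: Rmult_lt_0_compat; lra.
have ? : 0 < exp (T1 / m) * (x T1 * - y' T1) by apply: Rmult_lt_0_compat.
lra.
Qed.

(** By continuity of the critical time in [s]. The slack allows a stiffness strictly below [k],
    which the sine force of the pendulum dominates at small angles. *)
Lemma phase_root_time_perturb (m s T : R) : 0 < m -> 0 < s ->
  phase_root s / (s / (2 * m)) < T ->
  exists s', 0 < s' < s /\ phase_root s' / (s' / (2 * m)) <= T.
Proof.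
move=> m0 s0 HT.
set g := fun s => phase_root s / (s / (2 * m)).
have Hs : s / (2 * m) <> 0 by apply: Rgt_not_eq; apply: Rdiv_lt_0_compat; lra.
have Hg : continuous g s.
  apply: ex_derive_continuous; rewrite /g /phase_root.
  by auto_derive; repeat split.
have Heps : 0 < T - g s by rewrite /g; lra.
have [[d d0] Hd] := Hg _ (locally_ball (g s) (mkposreal _ Heps)).
set e := Rmin (d / 2) (s / 2).
have e0 : 0 < e by apply: Rmin_pos; lra.
have ? : e <= d / 2 by exact: Rmin_l.
have ? : e <= s / 2 by exact: Rmin_r.
exists (s - e); split; first by lra.
have := Hd (s - e).
rewrite /ball /= /AbsRing_ball /abs /minus /plus /opp /= -/(g (s - e)) => H.
have {H} := H ltac:(by apply: Rabs_def1; lra) => /Rabs_def2; lra.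
Qed.

Section Shooting.
Variables (m k T : R) (X V : R -> R -> R).
Hypotheses (m_gt0 : 0 < m) (k_gt0 : 0 < k) (T_gt0 : 0 < T).
Hypothesis X_ode : forall a, pendulum_ode m k (X a) (V a).
Hypothesis X0 : forall a, X a 0 = a.
Hypothesis V0 : forall a, V a 0 = 0.
Hypothesis large : 1 < 4 * m * k.
Hypothesis late : phase_root (sqrt (4 * m * k - 1)) /
  (sqrt (4 * m * k - 1) / (2 * m)) < T.

Let M := exp ((1 + (k + 2) / m) * T).

Let M_ge1 : 1 <= M.
Proof.
rewrite /M -[X in X <= _]exp_0; apply: exp_le.
have ? : 0 < (k + 2) / m by apply: Rdiv_lt_0_compat; lra.
apply: Rmult_le_pos; lra.
Qed.

Let lipschitz (x v : R -> R) (a p t : R) : pendulum_ode m k x v ->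
  x 0 = p -> v 0 = 0 -> 0 <= t <= T -> Rabs (X a t - x t) <= M * Rabs (a - p).
Proof.
move=> Hx Hx0 Hv0 Ht.
have [H _] := pendulum_gronwall m_gt0 k_gt0 (proj1 Ht) (X_ode a) Hx.
rewrite X0 V0 Hx0 Hv0 in H.
have Hexp : exp ((1 + (k + 2) / m) * t) <= M.
  apply: exp_le; apply: Rmult_le_compat_l; last by lra.
  have ? : 0 < (k + 2) / m by apply: Rdiv_lt_0_compat; lra.
  lra.
have ? := pow2_ge_0 (V a t - v t); have ? := pow2_ge_0 (a - p).
(* Gronwall bounds the square by a factor at most [M], and [M <= M ^ 2] because [M >= 1]; hence [M]
   itself is a Lipschitz constant. *)
have H2 : (X a t - x t) ^ 2 <= (M * Rabs (a - p)) ^ 2.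
  rewrite Rpow_mult_distr pow2_abs; have ? := exp_pos ((1 + (k + 2) / m) * t).
  have H3 : exp ((1 + (k + 2) / m) * t) <= M ^ 2 by nra.
  have H4 := Rmult_le_compat_r ((a - p) ^ 2) _ _ ltac:(lra) H3.
  rewrite Rminus_diag in H; nra.
rewrite -[X in _ <= X]Rabs_pos_eq; last first.
  by apply: Rmult_le_pos; [lra | exact: Rabs_pos].
by apply: Rsqr_le_abs_0; rewrite !Rsqr_pow2.
Qed.

Let positive a := forall t, 0 <= t <= T -> 0 < X a t.

Let continuous_X a t : 0 <= t -> continuous (X a) t.
Proof. by move=> Ht; exact: (continuous_is_derive (proj1 (X_ode a Ht))). Qed.

(** Amplitudes within [PI / (2 * M)] of the upper rest position stay within [PI / 2] of it up to
    time [T]. *)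
Let near_pi : exists a1, 0 < a1 < PI /\ forall a, a1 <= a <= PI -> positive a.
Proof.
have ? := PI_RGT_0.
exists (PI - PI / (2 * M)).
have H : 0 < PI / (2 * M) by apply: Rdiv_lt_0_compat; lra.
have H1 : M * (PI / (2 * M)) = PI / 2 by field; lra.
split; first by nra.
move=> a Ha t Ht.
have := lipschitz a (pendulum_ode_const m k sin_PI) erefl erefl Ht.
rewrite (Rabs_left1 (a - PI)); last by lra.
move=> /Rabs_le_between; nra.
Qed.

Let near_zero : exists a0, 0 < a0 < PI /\ ~ positive a0.
Proof.
have Hpi := PI_RGT_0.
have Hl := late; set s := sqrt (4 * m * k - 1) in Hl.
have s0 : 0 < s by apply: sqrt_lt_R0; lra.
have Hs : s * s = 4 * m * k - 1 by apply: sqrt_sqrt; lra.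
have [s' [Hs' HT]] := phase_root_time_perturb m_gt0 s0 Hl.
(* Ratio of the lowered stiffness to [k]. With [b = acos c] the bound [sin y >= y * cos b] on
   [[0, b]] is the required comparison of forces. *)
set c := (1 + s' * s') / (4 * m * k).
have Hc : 0 < c < 1.
  split; first by apply: Rdiv_lt_0_compat; nra.
  by apply/Rlt_div_l; [lra | nra].
have Hcos : cos (acos c) = c by apply: cos_acos; lra.
have [Hb1 Hb2] := acos_bound c.
set b := acos c in Hcos Hb1 Hb2.
have b0 : 0 < b.
  by case: Hb1 => // Hb; move: Hcos; rewrite -Hb cos_0 => ?; lra.
have b1 : b <= PI / 2.
  apply: Rnot_lt_le => Hb.
  have ? := cos_lt_0 b Hb ltac:(lra); lra.
(* Comparison with the rest state 0 keeps this trajectory below [b] on [[0, T]]. *)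
exists (b / M).
have HM : M * (b / M) = b by field; lra.
have Ha : 0 < b / M by apply: Rdiv_lt_0_compat; lra.
split; first by nra.
move=> Hpos; apply: (pendulum_not_positive (b := b) m_gt0 (proj1 Hs') HT
  (X_ode (b / M)) (V0 _)).
  move=> y Hy; have := sin_ge_cos_mul Hy b1; rewrite Hcos => H.
  have -> : (1 + s' * s') / (4 * m) * y = k * (y * c) by rewrite /c; field; lra.
  by apply: Rmult_le_compat_l; lra.
move=> t Ht; split; first exact: Hpos.
have := lipschitz (b / M) (pendulum_ode_const m k sin_0) erefl erefl Ht.
rewrite !Rminus_0_r (Rabs_pos_eq (b / M)); last by lra.
by rewrite HM => /Rabs_le_between; lra.
Qed.

(** By compactness the trajectory has a positive minimum on [[0, T]], and the Lipschitz bound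
    transfers positivity to nearby amplitudes. *)
Let positive_open a : positive a ->
  exists e, 0 < e /\ forall a', Rabs (a' - a) < e -> positive a'.
Proof.
move=> Ha.
have [||mx [Hmx Hmx2]] := continuity_ab_min (X a) 0 T; first by lra.
  by move=> c Hc; apply/continuity_pt_filterlim; apply: continuous_X; lra.
have Hmin := Ha mx Hmx2.
exists (X a mx / M); split; first by apply: Rdiv_lt_0_compat; lra.
move=> a' Ha' t Ht.
have := lipschitz a' (X_ode a) (X0 a) (V0 a) Ht.
have {}Ha' : M * Rabs (a' - a) < X a mx.
  by rewrite Rmult_comm; apply/Rlt_div_r => //; lra.
have ? := Hmx t Ht.
by move=> /Rabs_le_between; lra.
Qed.

(** The backward Gronwall bound against the zero solution: reaching 0 at rest would force
    [a = 0]. *)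
Let not_at_rest a t : a <> 0 -> 0 <= t -> X a t = 0 -> V a t <> 0.
Proof.
move=> Ha Ht Hx Hv; apply: Ha.
have [_] := pendulum_gronwall m_gt0 k_gt0 Ht (X_ode a)
  (pendulum_ode_const m k sin_0).
rewrite X0 V0 Hx Hv !Rminus_0_r => H.
by have ? := pow2_ge_0 a; nra.
Qed.

(* At the supremum of the amplitudes whose trajectory reaches zero on [0, T],
   the trajectory stays nonnegative, so it can only vanish at time T. *)
Lemma pendulum_shooting : exists a, X a T = 0 /\ V a T <> 0.
Proof.
have [a0 [Ha0 Hn0]] := near_zero.
have [a1 [Ha1 Hp1]] := near_pi.
set S := fun a => a0 <= a <= PI /\ ~ positive a.
have Sa0 : S a0 by split=> //; lra.
have Sub a : S a -> a <= a1.
  move=> [Ha Hn]; apply: Rnot_lt_le => Hlt; apply: Hn; apply: Hp1; lra.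
have [] := completeness S; [by exists a1 | by exists a0 |].
move=> a [Hub Hleast].
have H0 := Hub _ Sa0.
have H1 : a <= a1 by apply: Hleast.
have Hafter a' : a < a' <= PI -> positive a'.
  move=> Ha'; apply: NNPP => Hn.
  have ? : a' <= a by apply: Hub; split=> //; lra.
  lra.
have Hna : ~ positive a.
  move=> Hp; have [e [e0 He]] := positive_open Hp.
  (* If [a] were positive, so would be every amplitude within [e] of it, and the supremum could be
     lowered. *)
  have : is_upper_bound S (a - e / 2).
    move=> a' Ha'; apply: Rnot_lt_le => Hlt.
    apply: (proj2 Ha'); apply: He.
    have ? := Hub _ Ha'; apply: Rabs_def1; lra.
  by move/Hleast => ?; lra.
(* Amplitudes just above [a] are positive; a negative value at [a] would survive a shift of the
   amplitude by the small [e]. *)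
have Hge t : 0 <= t <= T -> 0 <= X a t.
  move=> Ht; apply: Rnot_lt_le => Hneg.
  set e := Rmin (PI - a) (- X a t / (2 * M)).
  have He : 0 < - X a t / (2 * M) by apply: Rdiv_lt_0_compat; lra.
  have e0 : 0 < e by apply: Rmin_pos; lra.
  have ? : e <= PI - a by exact: Rmin_l.
  have ? : e <= - X a t / (2 * M) by exact: Rmin_r.
  have Hp := Hafter (a + e) ltac:(lra) t Ht.
  have := lipschitz (a + e) (X_ode a) (X0 a) (V0 a) Ht.
  have -> : a + e - a = e by ring.
  rewrite (Rabs_pos_eq e); last by lra.
  have ? : M * (- X a t / (2 * M)) = - X a t / 2 by field; lra.
  have ? : M * e <= M * (- X a t / (2 * M)) by apply: Rmult_le_compat_l; lra.
  by move=> /Rabs_le_between; lra.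
have [t Ht] : exists t, ~ (0 <= t <= T -> 0 < X a t) by exact: not_all_ex_not.
have [Ht1 Ht2] := imply_to_and _ _ Ht.
have Hx : X a t = 0 by have ? := Hge t Ht1; lra.
have t0 : t <> 0 by move=> E; move: Hx; rewrite E X0; lra.
have Hv : V a t <> 0 by apply: not_at_rest => //; lra.
(* A zero before [T] would be an interior minimum of a nonnegative function, so the velocity would
   vanish there. *)
have [tT|tT] := Rle_lt_or_eq_dec _ _ (proj2 Ht1); last first.
  by exists a; rewrite -tT.
exfalso; apply: Hv.
have Hd := proj1 (X_ode a (proj1 Ht1)).
have pr : derivable_pt (X a) t by exists (V a t); exact/is_derive_Reals.
rewrite -(is_derive_unique _ _ _ Hd) -(Derive_Reals _ _ pr).
apply: (deriv_minimum _ 0 T) => //; first by lra.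
by move=> u u0 uT; rewrite Hx; apply: Hge; lra.
Qed.

End Shooting.

Lemma kuramoto_non_determination (m kappa T : R) :
  0 < kappa -> 0 < m -> 0 < T -> 1 < 4 * m * kappa ->
  phase_root (sqrt (4 * m * kappa - 1)) / (sqrt (4 * m * kappa - 1) / (2 * m)) < T ->
  exists (nu : 'I_2 -> R) (theta theta' phi phi' : 'I_2 -> R -> R),
    [/\ kuramoto_solution m kappa nu theta theta',
        kuramoto_solution m kappa nu phi phi',
        (forall i, theta' i 0 = phi' i 0),
        (forall i, theta i T = phi i T)
      & exists i, theta' i T <> phi' i T].
Proof.
move=> k0 m0 T0 Hlarge Hlate.
have Hode a : pendulum_ode m kappa (pendulum m kappa a) (pendulum_velocity m kappa a).
  move=> t Ht; split; first exact: is_derive_pendulum.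
  exact: is_derive_pendulum_velocity.
have [a [HX HV]] := pendulum_shooting m0 k0 T0 Hode
  (pendulum_at0 m kappa) (pendulum_velocity_at0 m kappa) Hlarge Hlate.
set x := pendulum m kappa a in HX; set v := pendulum_velocity m kappa a in HV.
(* Opposite positions [- x / 2] and [x / 2] have difference [x]; each oscillator feels [kappa / 2]
   times the sine of it, so [x] is the pendulum with [k = kappa]. *)
set c : 'I_2 -> R := fun i => if i == ord0 then - / 2 else / 2.
exists (fun _ => 0), (fun i t => c i * x t), (fun i t => c i * v t),
  (fun _ _ => 0), (fun _ _ => 0).
split.
- exists (fun i t => c i * ((- kappa * sin (x t) - v t) / m)) => i t Ht.
  have [Hx Hv] := Hode a t Ht.
  split; first by apply: is_derive_D_in; exact: is_derive_scal.
  split.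
    apply: (@is_derive_D_in _ (fun t => c i * ((- kappa * sin (x t) - v t) / m))).
    exact: is_derive_scal.
  rewrite !big_ord_recl big_ord0.
  have [Hi|Hi] : c i = - / 2 \/ c i = / 2 by rewrite /c; case: ifP; [left|right].
  + have -> : c i = c ord0 by rewrite Hi.
    rewrite Rminus_diag sin_0.
    have -> : c (lift ord0 ord0) * x t - c ord0 * x t = x t by rewrite /c /=; field.
    by rewrite /c /=; field; lra.
  + have -> : c i = c (lift ord0 ord0) by rewrite Hi.
    rewrite Rminus_diag sin_0.
    have -> : c ord0 * x t - c (lift ord0 ord0) * x t = - x t by rewrite /c /=; field.
    by rewrite sin_neg /c /=; field; lra.
- exists (fun _ _ => 0) => i t Ht; split.
    apply: is_derive_D_in; exact: (is_derive_const (V := R_NormedModule)).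
  split.
    apply: is_derive_D_in; exact: (is_derive_const (V := R_NormedModule)).
  by rewrite big1 => [|j _]; [ring | rewrite Rminus_diag sin_0].
- by move=> i; rewrite /v pendulum_velocity_at0; ring.
- by move=> i; rewrite HX; ring.
- exists ord0; rewrite /c /=; lra.
Qed.

(** * The velocity map *)

(** Projection onto [[0, T]]. Composing with it extends a function continuous on [[0, T]] to one
    continuous on the whole line, without changing it on [[0, T]]. *)
Definition clamp (T t : R) : R := Rmax 0 (Rmin t T).

Lemma clamp_bounds (T t : R) : 0 <= T -> 0 <= clamp T t <= T.
Proof.
move=> HT; split; first exact: Rmax_l.
by apply: Rmax_lub => //; exact: Rmin_r.
Qed.

Lemma clamp_id (T t : R) : 0 <= t <= T -> clamp T t = t.
Proof. by move=> Ht; rewrite /clamp Rmin_left ?Rmax_right; lra. Qed.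

Lemma continuous_clamp (T t : R) : continuous (clamp T) t.
Proof.
apply: (continuous_ext (fun t => (0 + (t + T - Rabs (t - T)) / 2 +
   Rabs (0 - (t + T - Rabs (t - T)) / 2)) / 2)).
  move=> s; rewrite /clamp.
  have -> : Rmin s T = (s + T - Rabs (s - T)) / 2.
    rewrite /Rmin; case: Rle_dec => H /=.
      by rewrite Rabs_left1; lra.
    by rewrite Rabs_right; lra.
  set y := (s + T - Rabs (s - T)) / 2.
  rewrite /Rmax; case: Rle_dec => H /=.
    by rewrite Rabs_left1; lra.
  by rewrite Rabs_right; lra.
have Hd (f g : R -> R) s : continuous f s -> continuous g s ->
    continuous (fun s => (f s + g s) / 2) s.
  move=> Hf Hg; apply: (continuous_mult (K := R_AbsRing)).
    exact: (continuous_plus (V := R_NormedModule)).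
  exact: continuous_const.
have Hmin : continuous (fun t => (t + T - Rabs (t - T)) / 2) t.
  apply: (Hd (fun t => t + T) (fun t => - Rabs (t - T))).
    by apply: (continuous_plus (V := R_NormedModule));
      [exact: continuous_id | exact: continuous_const].
  apply: (continuous_opp (V := R_NormedModule)).
  apply: continuous_Rabs_comp.
  by apply: (continuous_minus (V := R_NormedModule));
    [exact: continuous_id | exact: continuous_const].
apply: (Hd (fun t => 0 + _)).
  by apply: (continuous_plus (V := R_NormedModule));
    [exact: continuous_const | exact: Hmin].
apply: continuous_Rabs_comp.
by apply: (continuous_minus (V := R_NormedModule));
  [exact: continuous_const | exact: Hmin].
Qed.

Lemma continuous_comp_clamp (T : R) (u : R -> R) : 0 <= T ->
  continuous_on (fun t : R => 0 <= t <= T) u ->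
  forall t, continuous (fun s => u (clamp T s)) t.
Proof.
move=> HT Hu t; have Ht := clamp_bounds t HT.
apply: filterlim_comp (Hu _ Ht) => P [e He].
have := @continuous_clamp T t => /filterlim_locally /(_ e) H.
by apply: filter_imp H => s Hs; apply: He => //; exact: clamp_bounds.
Qed.

(** * The supremum norm and contractions *)

Section SupNorm.
Variable T : R.
Hypothesis T_ge0 : 0 <= T.

(** [real] sends infinite values to 0, so finiteness has to be checked: the value at 0 excludes
    minus infinity and [B] excludes plus infinity. *)
Lemma sup_norm_is_lub (u : R -> R) (B : R) :
  (forall t, 0 <= t <= T -> Rabs (u t) <= B) ->
  is_lub_Rbar (fun x : R => exists t : R, 0 <= t <= T /\ x = Rabs (u t))
    (sup_norm T u).
Proof.
move=> HB; rewrite /sup_norm.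
have [Hub Hl] := Lub_Rbar_correct
  (fun x : R => exists t : R, 0 <= t <= T /\ x = Rabs (u t)).
have H1 := Hub (Rabs (u 0)) ltac:(by exists 0; split; lra).
have H2 := Hl (Finite B) ltac:(by move=> x [t [Ht ->]]; exact: HB).
move: Hub Hl H1 H2.
by case: (Lub_Rbar _).
Qed.

Lemma sup_norm_le (u : R -> R) (B : R) :
  (forall t, 0 <= t <= T -> Rabs (u t) <= B) -> sup_norm T u <= B.
Proof.
move=> HB; have [_ Hl] := sup_norm_is_lub HB.
by apply: (Hl (Finite B)) => x [t [Ht ->]]; exact: HB.
Qed.

Lemma le_sup_norm (u : R -> R) (t : R) :
  continuous_on (fun t : R => 0 <= t <= T) u -> 0 <= t <= T ->
  Rabs (u t) <= sup_norm T u.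
Proof.
move=> Hu Ht.
have [|M [HM _]] := continuity_ab_maj (fun s => Rabs (u (clamp T s))) 0 T T_ge0.
  move=> c _; apply/continuity_pt_filterlim; apply: continuous_Rabs_comp.
  exact: continuous_comp_clamp.
have HB s : 0 <= s <= T -> Rabs (u s) <= Rabs (u (clamp T M)).
  by move=> Hs; have := HM s Hs; rewrite (clamp_id Hs).
have [Hub _] := sup_norm_is_lub HB.
by apply: (Hub (Rabs (u t))); exists t.
Qed.

Lemma eq_sup_norm (u w : R -> R) :
  (forall t, 0 <= t <= T -> u t = w t) -> sup_norm T u = sup_norm T w.
Proof.
move=> H; rewrite /sup_norm; congr real; apply: Lub_Rbar_eqset => x.
by split=> -[t [Ht ->]]; exists t; split=> //; rewrite H.
Qed.

Lemma norm_CN_ge0 (N : nat) (Omega : 'I_N -> R -> R) : 0 <= norm_CN T Omega.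
Proof.
rewrite /norm_CN; case: N Omega => [|N] Omega.
  by rewrite big_ord0; lra.
elim: N Omega => [|N IH] Omega; rewrite big_ord_recl /=.
  by rewrite big_ord0; exact: Rmax_r.
by apply: Rle_trans (Rmax_r _ _); exact: IH.
Qed.

Lemma norm_CN_le (N : nat) (Omega : 'I_N -> R -> R) (B : R) : 0 <= B ->
  (forall i t, 0 <= t <= T -> Rabs (Omega i t) <= B) -> norm_CN T Omega <= B.
Proof.
move=> B0 H; rewrite /norm_CN.
elim/big_ind: _ => [//|x y Hx Hy|i _]; first exact: Rmax_lub.
by apply: sup_norm_le => t Ht; exact: H.
Qed.

Lemma le_norm_CN (N : nat) (Omega : 'I_N -> R -> R) (i : 'I_N) (t : R) :
  in_CN T Omega -> 0 <= t <= T -> Rabs (Omega i t) <= norm_CN T Omega.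
Proof.
move=> HO Ht; apply: (Rle_trans _ _ _ (le_sup_norm (HO i) Ht)).
rewrite /norm_CN; elim: N Omega i HO => [|N IH] Omega i HO; first by case: i.
rewrite big_ord_recl; case: (unliftP ord0 i) => [j ->|->]; last exact: Rmax_l.
apply: Rle_trans (Rmax_r _ _).
by apply: (IH (fun j => Omega (lift ord0 j))) => k; exact: HO.
Qed.

Lemma in_CN_minus (N : nat) (Omega Omega' : 'I_N -> R -> R) :
  in_CN T Omega -> in_CN T Omega' ->
  in_CN T (fun i t => Omega i t - Omega' i t).
Proof.
move=> H H' i t Ht.
apply: (filterlim_comp_2 (Omega i) (fun s => opp (Omega' i s)) plus
  (H i t Ht) _ (filterlim_plus (V := R_NormedModule) _ _)).
exact: filterlim_comp (H' i t Ht) (filterlim_opp (V := R_NormedModule) _).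
Qed.

Lemma le_dist_CN (N : nat) (Omega Omega' : 'I_N -> R -> R) (i : 'I_N) (t : R) :
  in_CN T Omega -> in_CN T Omega' -> 0 <= t <= T ->
  Rabs (Omega i t - Omega' i t) <= dist_CN T Omega Omega'.
Proof. by move=> H H' Ht; exact: (le_norm_CN _ (in_CN_minus H H')). Qed.

Lemma eq_dist_CN (N : nat) (A A' B B' : 'I_N -> R -> R) :
  eq_CN T A A' -> eq_CN T B B' -> dist_CN T A B = dist_CN T A' B'.
Proof.
move=> HA HB; apply: eq_bigr => i _; apply: eq_sup_norm => t Ht.
by rewrite HA // HB.
Qed.

Lemma eq_in_CN (N : nat) (A B : 'I_N -> R -> R) :
  eq_CN T A B -> in_CN T A -> in_CN T B.
Proof.
move=> H HA i; apply: continuous_on_ext (HA i) => t Ht; exact: H.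
Qed.

Lemma contraction_CN_unique (N : nat)
    (F : ('I_N -> R -> R) -> ('I_N -> R -> R)) (Omega Omega' : 'I_N -> R -> R) :
  contraction_CN T F -> in_CN T Omega -> in_CN T Omega' ->
  eq_CN T (F Omega) Omega -> eq_CN T (F Omega') Omega' -> eq_CN T Omega Omega'.
Proof.
move=> [_ [q [Hq HF]]] H H' E E' i t Ht.
have := HF _ _ H H'; rewrite (eq_dist_CN E E') => Hd.
have ? : 0 <= dist_CN T Omega Omega' by exact: norm_CN_ge0.
have := le_dist_CN i H H' Ht => /Rabs_le_between ?; nra.
Qed.

Lemma contraction_CN_iter (N : nat)
    (F : ('I_N -> R -> R) -> ('I_N -> R -> R)) (Omega Omega' : 'I_N -> R -> R) :
  contraction_CN T F -> in_CN T Omega -> in_CN T Omega' ->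
  eq_CN T (F Omega') Omega' ->
  is_lim_seq (fun n => dist_CN T (iter n F Omega) Omega') 0.
Proof.
move=> [Hin [q [Hq HF]]] H H' E'.
have Hn n : in_CN T (iter n F Omega) by elim: n => //= n; exact: Hin.
have Hb n : dist_CN T (iter n F Omega) Omega' <= q ^ n * dist_CN T Omega Omega'.
  elim: n => [|n IH]; first by rewrite /=; lra.
  rewrite iterS -(eq_dist_CN (fun _ _ _ => erefl) E').
  apply: (Rle_trans _ _ _ (HF _ _ (Hn n) H')); rewrite /= Rmult_assoc.
  by apply: Rmult_le_compat_l; lra.
apply: (is_lim_seq_le_le (fun _ => 0) _
  (fun n => q ^ n * dist_CN T Omega Omega')).
- by move=> n; split; [exact: norm_CN_ge0 | exact: Hb].
- exact: is_lim_seq_const.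
- have -> : Finite 0 = Rbar_mult 0 (dist_CN T Omega Omega').
    by rewrite /= Rmult_0_l.
  apply: is_lim_seq_scal_r; apply: is_lim_seq_geom.
  by rewrite Rabs_pos_eq; lra.
Qed.

End SupNorm.

(** * Lipschitz bounds and fixed point of the velocity map *)

Section VelocityMap.
Variables (N : nat) (m kappa T : R) (nu omega0 thetaT : 'I_N -> R).
Hypotheses (m_gt0 : 0 < m) (kappa_gt0 : 0 < kappa) (T_gt0 : 0 < T).
Hypothesis N_gt0 : 0 < INR N.

Let Fmap := velocity_map m kappa T nu omega0 thetaT.

(** Lets a path be replaced by its clamped extension, or a velocity by its two-sided extension. *)
Lemma eq_velocity_map (A B : 'I_N -> R -> R) :
  eq_CN T A B -> eq_CN T (Fmap A) (Fmap B).
Proof.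
move=> H i t Ht; rewrite /Fmap /velocity_map; congr (_ + _ * _).
apply: eq_bigr => l _; apply: RInt_ext => s.
rewrite Rmin_left ?Rmax_right => [Hs||]; [|lra..].
do 3 f_equal; apply: RInt_ext => u.
rewrite Rmin_left ?Rmax_right => [Hu||]; [|lra..].
by rewrite !H //; lra.
Qed.

Section Continuous.
Variable A : 'I_N -> R -> R.
Hypothesis A_cont : forall i t, continuous (A i) t.

Lemma continuous_relative_velocity (l i : 'I_N) (t : R) :
  continuous (fun tau => A l tau - A i tau) t.
Proof. by apply: (continuous_minus (V := R_NormedModule)). Qed.

Lemma continuous_phase_sin (l i : 'I_N) (t : R) :
  continuous (fun s => sin (thetaT l - thetaT i -
    RInt (fun tau => A l tau - A i tau) s T)) t.
Proof.
apply: continuous_sin_comp; apply: (continuous_minus (V := R_NormedModule)).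
  exact: continuous_const.
apply: (continuous_ext (fun s => - RInt (fun tau => A l tau - A i tau) T s)).
  move=> s; apply: opp_RInt_swap.
  apply: ex_RInt_continuous => *; exact: continuous_relative_velocity.
apply: (continuous_opp (V := R_NormedModule)).
apply: continuous_is_derive; apply: is_derive_RInt_continuous.
exact: continuous_relative_velocity.
Qed.

Lemma continuous_memory_integrand (l i : 'I_N) (t s : R) :
  continuous (fun s => exp (- (t - s) / m) * sin (thetaT l - thetaT i -
    RInt (fun tau => A l tau - A i tau) s T)) s.
Proof.
apply: (continuous_mult (K := R_AbsRing)); last exact: continuous_phase_sin.
by apply: ex_derive_continuous; auto_derive.
Qed.

Lemma continuous_velocity_map (i : 'I_N) (t : R) : continuous (Fmap A i) t.
Proof.
have He (f : R -> R) : ex_derive f t -> continuous f t.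
  exact: ex_derive_continuous.
rewrite /Fmap /velocity_map.
apply: (continuous_plus (V := R_NormedModule)).
  by apply: He; auto_derive.
apply: (continuous_mult (K := R_AbsRing)); first exact: continuous_const.
apply: continuous_rsum => l.
apply: (continuous_ext (fun t => exp (- t / m) * RInt (fun s => exp (s / m) *
   sin (thetaT l - thetaT i - RInt (fun tau => A l tau - A i tau) s T)) 0 t)).
  move=> u.
  apply: (etrans (esym (RInt_scal (V := R_CompleteNormedModule) _ 0 u _ _))).
    apply: ex_RInt_continuous => s _.
    apply: (continuous_mult (K := R_AbsRing)); last exact: continuous_phase_sin.
    exact: continuous_exp_div.
  apply: RInt_ext => s _; rewrite /scal /= /mult /= -Rmult_assoc -exp_plus.
  by congr (exp _ * _); field; lra.
apply: (continuous_mult (K := R_AbsRing)).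
  by apply: He; auto_derive.
apply: continuous_is_derive; apply: is_derive_RInt_continuous => s.
apply: (continuous_mult (K := R_AbsRing)); last exact: continuous_phase_sin.
exact: continuous_exp_div.
Qed.

End Continuous.

Section Estimate.
Variables (A B : 'I_N -> R -> R) (d : R).
Hypothesis A_cont : forall i t, continuous (A i) t.
Hypothesis B_cont : forall i t, continuous (B i) t.
Hypothesis AB_dist : forall i t, 0 <= t <= T -> Rabs (A i t - B i t) <= d.

Let phase_diff (l i : 'I_N) (s : R) : 0 <= s <= T ->
  Rabs (sin (thetaT l - thetaT i - RInt (fun tau => A l tau - A i tau) s T) -
        sin (thetaT l - thetaT i - RInt (fun tau => B l tau - B i tau) s T))
  <= 2 * (T - s) * d.
Proof.
move=> Hs; apply: (Rle_trans _ _ _ (sin_diff_le _ _)).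
have HI C : (forall i t, continuous (C i) t) ->
    ex_RInt (fun tau => C l tau - C i tau) s T.
  move=> HC; apply: ex_RInt_continuous => *.
  exact: continuous_relative_velocity.
have -> : thetaT l - thetaT i - RInt (fun tau => A l tau - A i tau) s T -
  (thetaT l - thetaT i - RInt (fun tau => B l tau - B i tau) s T) =
  RInt (fun tau => minus (B l tau - B i tau) (A l tau - A i tau)) s T.
  rewrite (RInt_minus (fun tau => B l tau - B i tau)
    (fun tau => A l tau - A i tau) _ _ (HI B B_cont) (HI A A_cont)).
  rewrite /minus /plus /opp /=; ring.
have -> : 2 * (T - s) * d = (T - s) * (2 * d) by ring.
apply: abs_RInt_le_const; first by lra.
  apply: (ex_RInt_minus (V := R_NormedModule));
    [exact: (HI B B_cont) | exact: (HI A A_cont)].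
move=> u Hu; have H1 := AB_dist l (t := u) ltac:(lra).
have H2 := AB_dist i (t := u) ltac:(lra).
have -> : minus (B l u - B i u) (A l u - A i u) =
  (A i u - B i u) + - (A l u - B l u) by rewrite /minus /plus /opp /=; ring.
apply: (Rle_trans _ _ _ (Rabs_triang _ _)); rewrite Rabs_Ropp; lra.
Qed.

Let d_ge0 : 'I_N -> 0 <= d.
Proof.
move=> i; apply: (Rle_trans _ _ _ (Rabs_pos (A i 0 - B i 0))).
by apply: AB_dist; lra.
Qed.

(** Common frame of the two Lipschitz estimates: [g] is a majorant of the integrand difference and
    [G] an explicit antiderivative of it. *)
Let memory_diff (l i : 'I_N) (t b : R) (g G : R -> R) : 0 <= t <= T ->
  (forall s, is_derive G s (g s)) -> (forall s, continuous g s) ->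
  (forall s, 0 <= s <= t -> exp (- (t - s) / m) * (2 * (T - s) * d) <= g s) ->
  G t - G 0 <= b ->
  Rabs (RInt (fun s => exp (- (t - s) / m) * sin (thetaT l - thetaT i -
    RInt (fun tau => A l tau - A i tau) s T)) 0 t -
  RInt (fun s => exp (- (t - s) / m) * sin (thetaT l - thetaT i -
    RInt (fun tau => B l tau - B i tau) s T)) 0 t) <= b.
Proof.
move=> Ht HG Hg Hle Hb; apply: Rle_trans Hb.
have HI C : (forall i t, continuous (C i) t) ->
  ex_RInt (fun s => exp (- (t - s) / m) * sin (thetaT l - thetaT i -
    RInt (fun tau => C l tau - C i tau) s T)) 0 t.
  move=> HC; apply: ex_RInt_continuous => *.
  exact: continuous_memory_integrand.
have H1 := is_RInt_minus _ _ _ _ _ _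
  (RInt_correct _ _ _ (HI A A_cont)) (RInt_correct _ _ _ (HI B B_cont)).
have H2 : is_RInt g 0 t (minus (G t) (G 0)).
  by apply: is_RInt_derive => *.
apply: (norm_RInt_le _ _ _ _ _ _ (proj1 Ht) _ H1 H2) => s Hs.
rewrite /norm /= /abs /minus /plus /opp /=.
apply: Rle_trans (Hle s Hs).
rewrite -[_ + - _]/(_ - _) -Rmult_minus_distr_l Rabs_mult.
rewrite Rabs_pos_eq; last by left; exact: exp_pos.
apply: Rmult_le_compat_l; first by left; exact: exp_pos.
by apply: phase_diff; lra.
Qed.

Let map_diff (i : 'I_N) (t b : R) :
  (forall l, Rabs (RInt (fun s => exp (- (t - s) / m) * sin (thetaT l - thetaT i -
    RInt (fun tau => A l tau - A i tau) s T)) 0 t -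
  RInt (fun s => exp (- (t - s) / m) * sin (thetaT l - thetaT i -
    RInt (fun tau => B l tau - B i tau) s T)) 0 t) <= b) ->
  Rabs (Fmap A i t - Fmap B i t) <= kappa / m * b.
Proof.
move=> /rsum_abs_le H; rewrite /Fmap /velocity_map.
rewrite rsum_minus in H; move: H.
set SA := \big[Rplus/0]_(l < N) _; set SB := \big[Rplus/0]_(l < N) _ => H.
match goal with |- Rabs ?X <= _ =>
  have -> : X = kappa / (INR N * m) * (SA - SB) by ring end.
have H0 : 0 < kappa / (INR N * m).
  by apply: Rdiv_lt_0_compat => //; exact: Rmult_lt_0_compat.
rewrite Rabs_mult Rabs_pos_eq; last by lra.
have -> : kappa / m * b = kappa / (INR N * m) * (INR N * b) by field; lra.
by apply: Rmult_le_compat_l; lra.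
Qed.

Lemma velocity_map_diff_damping (i : 'I_N) (t : R) : 0 <= t <= T ->
  Rabs (Fmap A i t - Fmap B i t) <= 2 * kappa * T * d.
Proof.
move=> Ht; have ? := d_ge0 i.
have -> : 2 * kappa * T * d = kappa / m * (2 * T * d * m) by field; lra.
apply: map_diff => l.
(* The kernel is kept and [T - s] replaced by [T]; the kernel integrates to at most [m], which
   cancels the factor [1 / m]. *)
apply: (@memory_diff l i t _ (fun s => exp (- (t - s) / m) * (2 * T * d))
  (fun s => 2 * T * d * m * exp (- (t - s) / m)) Ht).
- by move=> s; auto_derive => //; rewrite /Rdiv /Rminus; field; lra.
- by move=> s; apply: ex_derive_continuous; auto_derive.
- move=> s Hs; apply: Rmult_le_compat_l; first by left; exact: exp_pos.
  by apply: Rmult_le_compat_r; lra.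
- rewrite Rminus_diag Ropp_0 /Rdiv Rmult_0_l exp_0.
  have ? := exp_pos (- (t - 0) * / m).
  have ? : 0 <= 2 * T * d * m by apply: Rmult_le_pos; nra.
  nra.
Qed.

Lemma velocity_map_diff_inertia (i : 'I_N) (t : R) : 0 <= t <= T ->
  Rabs (Fmap A i t - Fmap B i t) <= kappa * T ^ 2 / m * d.
Proof.
move=> Ht; have ? := d_ge0 i.
have -> : kappa * T ^ 2 / m * d = kappa / m * (d * T ^ 2) by field; lra.
apply: map_diff => l.
(* The kernel is replaced by 1; the integral of [2 * (T - s)] over [[0, t]] is
   [T ^ 2 - (T - t) ^ 2], at most [T ^ 2]. *)
apply: (@memory_diff l i t _ (fun s => 2 * (T - s) * d)
  (fun s => - (d * (T - s) ^ 2)) Ht).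
- by move=> s; auto_derive => //; ring.
- by move=> s; apply: ex_derive_continuous; auto_derive.
- move=> s Hs; rewrite -[X in _ <= X]Rmult_1_l.
  apply: Rmult_le_compat_r; first by apply: Rmult_le_pos; lra.
  rewrite -exp_0; apply: exp_le.
  have ? : 0 <= (t - s) / m by apply: Rdiv_le_0_compat; lra.
  have -> : - (t - s) / m = - ((t - s) / m) by field; lra.
  lra.
- have ? := pow2_ge_0 (T - t); rewrite Rminus_0_r; nra.
Qed.

End Estimate.

Lemma velocity_map_contraction :
  T < Rmax (1 / (2 * kappa)) (sqrt (m / kappa)) -> contraction_CN T Fmap.
Proof.
move=> HT; have T0 := Rlt_le _ _ T_gt0.
(* The estimates concern paths continuous on the whole line; clamping provides them without changing
   the map on [[0, T]]. *)
set ext := fun (A : 'I_N -> R -> R) i t => A i (clamp T t).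
have ext_eq A : eq_CN T A (ext A) by move=> i t Ht; rewrite /ext clamp_id.
have ext_cont A : in_CN T A -> forall i t, continuous (ext A i) t.
  by move=> HA i t; exact: continuous_comp_clamp.
split.
  move=> A HA; apply: (eq_in_CN (A := Fmap (ext A))).
    by move=> i t Ht; rewrite -(eq_velocity_map (ext_eq A)).
  move=> i; apply: continuous_on_forall => t _.
  exact/continuous_velocity_map/ext_cont.
have [q [Hq Hdiff]] : exists q, 0 <= q < 1 /\ forall A B d i t,
    (forall i t, continuous (A i) t) -> (forall i t, continuous (B i) t) ->
    (forall i t, 0 <= t <= T -> Rabs (A i t - B i t) <= d) ->
    0 <= t <= T -> Rabs (Fmap A i t - Fmap B i t) <= q * d.
  have [H|H] : T < 1 / (2 * kappa) \/ T < sqrt (m / kappa).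
    by move: HT; rewrite /Rmax; case: Rle_dec => _ /=; [right | left].
  - exists (2 * kappa * T); split.
      split; first by nra.
      by rewrite Rmult_comm; apply/Rlt_div_r => //; lra.
    by move=> A B d i t HA HB HAB Ht; exact: velocity_map_diff_damping.
  - exists (kappa * T ^ 2 / m); split.
      have Hmk : 0 < m / kappa by apply: Rdiv_lt_0_compat.
      split.
        apply: Rdiv_le_0_compat => //; apply: Rmult_le_pos; first by lra.
        exact: pow2_ge_0.
      apply/Rlt_div_l => //.
      have H2 : sqrt (m / kappa) * sqrt (m / kappa) = m / kappa.
        by apply: sqrt_sqrt; lra.
      have H3 : T * T < m / kappa by rewrite -H2; apply: Rmult_le_0_lt_compat.
      have := Rmult_lt_compat_l kappa _ _ kappa_gt0 H3.
      have -> : kappa * (m / kappa) = m by field; lra.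
      by rewrite /= => ?; lra.
    by move=> A B d i t HA HB HAB Ht; exact: velocity_map_diff_inertia.
exists q; split=> // A B HA HB.
have Hd : 0 <= dist_CN T A B by exact: norm_CN_ge0.
apply: norm_CN_le => //; first by nra.
move=> i t Ht.
rewrite (eq_velocity_map (ext_eq A)) // (eq_velocity_map (ext_eq B)) //.
apply: Hdiff => //; [exact: ext_cont..|].
move=> j s Hs; rewrite /ext; apply: le_dist_CN => //.
exact: clamp_bounds.
Qed.

Variables theta theta' : 'I_N -> R -> R.
Hypothesis sol : kuramoto_solution m kappa nu theta theta'.

Lemma kuramoto_velocity_in_CN : in_CN T theta'.
Proof.
have [th [om H]] := kuramoto_extension m_gt0 sol.
apply: (eq_in_CN (A := om)); first by move=> i t [Ht _]; case: (H i t Ht).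
move=> i; apply: continuous_on_forall => t [Ht _].
by have [_ _ _ Hd] := H i t Ht; exact: continuous_is_derive Hd.
Qed.

Hypothesis start : forall i, theta' i 0 = omega0 i.
Hypothesis final : forall i, theta i T = thetaT i.

(* Variation of constants: [exp (- (t - s) / m) (omega_i s - nu_i)] is an
   antiderivative in [s] of the integrand. *)
Lemma kuramoto_velocity_fixpoint : eq_CN T (Fmap theta') theta'.
Proof.
have [th [om H]] := kuramoto_extension m_gt0 sol.
have Eom : eq_CN T theta' om by move=> j s [Hs _]; case: (H j s Hs).
have Hth j s : 0 <= s -> is_derive (th j) s (om j s) by case/(H j s).
have Hom j s (Hs : 0 <= s) := let: And4 _ _ _ h := H j s Hs in h.
have om_cont j s : 0 <= s -> continuous (om j) s.
  by move=> Hs; exact: continuous_is_derive (Hom j s Hs).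
have th_cont j s : 0 <= s -> continuous (th j) s.
  by move=> Hs; exact: continuous_is_derive (Hth j s Hs).
have HthT j : th j T = thetaT j.
  by have [-> _ _ _] := H j T (Rlt_le _ _ T_gt0).
move=> i t Ht; rewrite (eq_velocity_map Eom) // Eom //.
(* Integrating velocity differences back from the final positions recovers the phase differences of
   the solution. *)
have Hphase l s : 0 <= s <= T ->
    thetaT l - thetaT i - RInt (fun tau => om l tau - om i tau) s T =
    th l s - th i s.
  move=> Hs.
  have HI : is_RInt (fun tau => om l tau - om i tau) s T
      (minus (th l T - th i T) (th l s - th i s)).
    apply: (is_RInt_derive (fun tau => th l tau - th i tau)) => u;
      rewrite Rmin_left ?Rmax_right => [Hu||]; try lra.
      by apply: (is_derive_minus (V := R_NormedModule)); apply: Hth; lra.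
    by apply: (continuous_minus (V := R_NormedModule)); apply: om_cont; lra.
  rewrite (is_RInt_unique _ _ _ _ HI) -!HthT /minus /plus /opp /=; ring.
have Hsin l s : 0 <= s -> continuous (fun s => exp (- (t - s) / m) *
    sin (th l s - th i s)) s.
  move=> Hs; apply: (continuous_mult (K := R_AbsRing)).
    by apply: ex_derive_continuous; auto_derive.
  apply: continuous_sin_comp; apply: (continuous_minus (V := R_NormedModule));
  exact: th_cont.
set g := fun s => kappa / (INR N * m) *
  \big[Rplus/0]_(l < N) (exp (- (t - s) / m) * sin (th l s - th i s)).
have H1 : is_RInt g 0 t (minus (exp (- (t - t) / m) * (om i t - nu i))
    (exp (- (t - 0) / m) * (om i 0 - nu i))).
  apply: (is_RInt_derive (fun s => exp (- (t - s) / m) * (om i s - nu i))) => s;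
    rewrite Rmin_left ?Rmax_right => [Hs||]; try lra.
    have Hd := Hom i s (proj1 Hs).
    auto_derive; first by repeat split=> //; eexists; eassumption.
    have -> := is_derive_unique (fun s => om i s) _ _ Hd.
    rewrite /g -big_distrr /= -/(Rminus t s) -/(Rdiv (- (t - s)) m).
    by field; lra.
  apply: (continuous_mult (K := R_AbsRing)); first exact: continuous_const.
  by apply: continuous_rsum => l; apply: Hsin; lra.
(* Second evaluation of the integral of [g], now term by term as in the velocity map; equating it
   with [H1] gives the fixed-point identity. *)
have H2 : is_RInt g 0 t (kappa / (INR N * m) * \big[Rplus/0]_(l < N)
    RInt (fun s => exp (- (t - s) / m) * sin (thetaT l - thetaT i -
      RInt (fun tau => om l tau - om i tau) s T)) 0 t).
  apply: (is_RInt_scal (V := R_NormedModule)); apply: is_RInt_rsum => l.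
  rewrite (RInt_ext _ (fun s => exp (- (t - s) / m) * sin (th l s - th i s))).
    apply: RInt_correct; apply: ex_RInt_continuous => s.
    by rewrite Rmin_left ?Rmax_right => [Hs||]; [apply: Hsin|..]; lra.
  move=> s; rewrite Rmin_left ?Rmax_right => [Hs||]; try lra.
  by rewrite Hphase //; lra.
have E := is_RInt_unique _ _ _ _ H1; rewrite (is_RInt_unique _ _ _ _ H2) in E.
rewrite /Fmap /velocity_map E /minus /plus /opp /= Rminus_diag Rminus_0_r.
have -> : om i 0 = omega0 i by rewrite -Eom //; lra.
rewrite Ropp_0 /Rdiv Rmult_0_l exp_0; ring.
Qed.

End VelocityMap.

Theorem theorem1p4 (kappa m T : R) (kappa_gt0 : 0 < kappa) (m_gt0 : 0 < m)
    (T_gt0 : 0 < T) :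
  ((forall (N : nat) (nu : 'I_N -> R)
       (theta theta' phi phi' : 'I_N -> R -> R),
      (1 <= N)%nat ->
      kuramoto_solution m kappa nu theta theta' ->
      kuramoto_solution m kappa nu phi phi' ->
      (forall i : 'I_N, theta' i 0 = phi' i 0) ->
      (forall i : 'I_N, theta i T = phi i T) ->
      forall i : 'I_N, theta' i T = phi' i T)
   <->
   (m * kappa <= 1 / 4 \/
    (m * kappa > 1 / 4 /\
     T <= PI * m / sqrt (4 * m * kappa - 1) +
          2 * m / sqrt (4 * m * kappa - 1) * asin (1 / sqrt (4 * m * kappa)))))
  /\
  (T < Rmax (1 / (2 * kappa)) (sqrt (m / kappa)) ->
   forall (N : nat) (nu omega0 thetaT : 'I_N -> R),
     (1 <= N)%nat ->
     contraction_CN T (velocity_map m kappa T nu omega0 thetaT) /\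
     forall theta theta' : 'I_N -> R -> R,
       kuramoto_solution m kappa nu theta theta' ->
       (forall i : 'I_N, theta' i 0 = omega0 i) ->
       (forall i : 'I_N, theta i T = thetaT i) ->
       [/\ in_CN T theta',
           eq_CN T (velocity_map m kappa T nu omega0 thetaT theta') theta',
           forall Omega : 'I_N -> R -> R, in_CN T Omega ->
             eq_CN T (velocity_map m kappa T nu omega0 thetaT Omega) Omega ->
             eq_CN T Omega theta'
         & forall Omega : 'I_N -> R -> R, in_CN T Omega ->
             is_lim_seq
               (fun n : nat =>
                  dist_CN T
                    (iter n (velocity_map m kappa T nu omega0 thetaT) Omega)
                    theta')
               0]).
Proof.
split; last first.
  move=> HT N nu omega0 thetaT N1.
  have HN : 0 < INR N by apply/lt_0_INR/leP.
  have Hc := velocity_map_contraction nu omega0 thetaT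
    m_gt0 kappa_gt0 T_gt0 HN HT.
  split=> // theta theta' sol start final.
  have T_ge0 := Rlt_le _ _ T_gt0.
  have Hin := kuramoto_velocity_in_CN (T := T) m_gt0 sol.
  have Hfix := kuramoto_velocity_fixpoint m_gt0 T_gt0 HN sol start final.
  split=> // Omega HO; last exact: contraction_CN_iter.
  by move=> E; exact: (contraction_CN_unique T_ge0 Hc).
split=> [Hdet|Hb N]; last exact: kuramoto_determination.
have [Hk|Hk] := Rle_lt_dec (m * kappa) (1 / 4); first by left.
right; split=> //; apply: Rnot_lt_le => HT.
have Hlarge : 1 < 4 * m * kappa by lra.
rewrite threshold_phase_root // in HT.
have [nu [th [om [ph [ch [Hth Hph H0 HT' [i Hi]]]]]]] :=
  kuramoto_non_determination kappa_gt0 m_gt0 T_gt0 Hlarge HT.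
exact/Hi/(Hdet _ _ _ _ _ _ _ Hth Hph H0 HT').
Qed.
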